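(* Suppose $\operatorname{char}(\mathbf{k})=p>0$ and let $d\geq 0$. If $d\not\equiv 0,1\pmod p$ then $h^j_{st}(T_p\operatorname{Sym}^d\Omega)=0$ for all $j$. If $d\equiv 0$ or $1\pmod p$, then \[ h^{|d|_p}_{st}(T_p\operatorname{Sym}^d\Omega)=1\quad\text{ and }\quad h^j_{st}(T_p\operatorname{Sym}^d\Omega)=0\ \text{ for }j\neq |d|_p.\]
   Context: $\mathbf{k}$ is an algebraically closed field. $\Omega$ is the cotangent sheaf of $\mathbb{P}^{n-1}$. For a homogeneous (strict) polynomial functor $\mathcal{P}$, the group $H^j(\mathbb{P}^{n-1},\mathcal{P}(\Omega))$ is a finite dimensional vector space independent of $n$ for $n\gg 0$; it is denoted $H^j_{st}(\mathcal{P}(\Omega))$ and its dimension is $h^j_{st}(\mathcal{P}(\Omega))$. The Frobenius power functor $F^p\subset\operatorname{Sym}^p$ is $F^pV=\{v^p:v\in V\}$, and the truncated symmetric power is $T_p\operatorname{Sym}^d=\operatorname{coker}\left(F^p\otimes\operatorname{Sym}^{d-p}\to\operatorname{Sym}^d\right)$, the map being polynomial multiplication (with $\operatorname{Sym}^{m}=0$ for $m<0$). For a non-negative integer $m\equiv 0,1\pmod p$, write $m=pa+b$ with $b\in\{0,1\}$; the $p$-index of $m$ is $|m|_p=2a+b$. *)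

(* Defs.v *)
From HB Require Import structures.
From mathcomp Require Import all_boot all_order all_fingroup all_algebra.
From mathcomp Require Import generic_quotient ring_quotient fraction.
From mathcomp Require Import boolp.
From mathcomp Require Import freeg mpoly.

Set Implicit Arguments.
Unset Strict Implicit.
Unset Printing Implicit Defensive.

Import GRing.Theory.
Local Open Scope ring_scope.
Local Open Scope quotient_scope.

Section QuotientModule.
Variables (A : comNzRingType) (V : lmodType A) (G : V -> Prop).

Inductive in_span : V -> Prop :=
| in_span0 : in_span 0
| in_spanS a g v : G g -> in_span v -> in_span (a *: g + v).

Definition span_pred : {pred V} := fun v => `[< in_span v >].

Lemma in_spanD u v : in_span u -> in_span v -> in_span (u + v).
Proof.
by elim=> [|a g w Gg _ IH] sv; rewrite ?add0r // -addrA; apply/in_spanS/IH.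
Qed.

Lemma in_spanZ b v : in_span v -> in_span (b *: v).
Proof.
elim=> [|a g w Gg _ IH]; first by rewrite scaler0; exact: in_span0.
by rewrite scalerDr scalerA; exact: in_spanS.
Qed.

Lemma span_zmod_closed : zmod_closed span_pred.
Proof.
split=> [|u v /asboolP su /asboolP sv]; apply/asboolP; first exact: in_span0.
by rewrite -scaleN1r; apply: in_spanD => //; exact: in_spanZ.
Qed.

HB.instance Definition _ := GRing.isZmodClosed.Build V span_pred
  span_zmod_closed.

(* V modulo the A-submodule generated by G *)
Definition qmod : Type := Quotient.quot (span_pred : zmodClosed V).

HB.instance Definition _ := Choice.on qmod.
HB.instance Definition _ := GRing.Zmodule.on qmod.
HB.instance Definition _ := EqQuotient.on qmod.

Definition qclass (v : V) : qmod := \pi_qmod v.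

Lemma qclassP u v : (qclass u == qclass v) = `[< in_span (u - v) >].
Proof. exact/esym/(Quotient.idealrBE (span_pred : zmodClosed V)). Qed.

Lemma qclassD u v : qclass (u + v) = qclass u + qclass v.
Proof. exact: (Quotient.pi_add (span_pred : zmodClosed V)). Qed.

Lemma qclassK (x : qmod) : qclass (repr x) = x.
Proof. exact: reprK. Qed.

Definition qscale (a : A) (x : qmod) : qmod := qclass (a *: repr x).

Lemma qclassZ a v : qclass (a *: v) = qscale a (qclass v).
Proof.
apply/eqP; rewrite qclassP -scalerBr; apply/asboolP/in_spanZ/asboolP.
by rewrite -qclassP qclassK.
Qed.

Fact qscaleA a b x : qscale a (qscale b x) = qscale (a * b) x.
Proof. by rewrite -[x]qclassK -!qclassZ scalerA. Qed.

Fact qscale1 : left_id 1 qscale.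
Proof. by move=> x; rewrite -[x]qclassK -!qclassZ scale1r. Qed.

Fact qscaleDr : right_distributive qscale +%R.
Proof.
move=> a x y; rewrite -[x]qclassK -[y]qclassK -qclassD -!qclassZ.
by rewrite scalerDr qclassD.
Qed.

Fact qscaleDl x : {morph qscale^~ x : a b / a + b}.
Proof. by move=> a b; rewrite -[x]qclassK -!qclassZ scalerDl qclassD. Qed.

HB.instance Definition _ := GRing.Zmodule_isLmodule.Build A qmod
  qscaleA qscale1 qscaleDr qscaleDl.

End QuotientModule.

Section InducedMaps.
Variables (A B : comNzRingType) (phi : A -> B).

Definition freeg_map (S T : choiceType) (f : S -> T) (x : {freeg S / A}) :
    {freeg T / B} :=
  \sum_(s <- dom x) << phi (coeff s x) *g f s >>.

(* The map induced on quotients by F; meaningful when F is additive,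
   phi-semilinear and maps the span of G into the span of G'; the value then
   does not depend on the representative. *)
Definition qmod_map (V : lmodType A) (W : lmodType B) (G : V -> Prop)
    (G' : W -> Prop) (F : V -> W) (x : qmod G) : qmod G' :=
  qclass G' (F (repr x)).

End InducedMaps.

Arguments qmod_map {A B V W G G'} F x.

Section Kaehler.
Variables (k A : comNzRingType) (iota : k -> A).

(* The generator << a >> stands for the differential d a. *)
Inductive kaehler_rel : {freeg A / A} -> Prop :=
| kaehlerD a b : kaehler_rel (<< a + b >> - << a >> - << b >>)
| kaehlerM a b : kaehler_rel (<< a * b >> - a *: << b >> - b *: << a >>)
| kaehlerC c : kaehler_rel << iota c >>.

Definition kaehler : lmodType A := qmod kaehler_rel.

End Kaehler.

Definition kaehler_map (k A B : comNzRingType) (iotaA : k -> A)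
    (iotaB : k -> B) (phi : A -> B) : kaehler iotaA -> kaehler iotaB :=
  qmod_map (freeg_map phi phi).

Arguments kaehler_map {k A B iotaA iotaB} phi.

Section SymmetricPowers.
Variables (A : comNzRingType) (M : lmodType A) (d : nat).

Definition upd (t : {ffun 'I_d -> M}) (i : 'I_d) (u : M) : {ffun 'I_d -> M} :=
  [ffun j => if j == i then u else t j].

(* The generator << t >> stands for the product \prod_(i < d) t i. *)
Inductive sym_rel : {freeg {ffun 'I_d -> M} / A} -> Prop :=
| symD t i u v :
    sym_rel (<< upd t i (u + v) >> - << upd t i u >> - << upd t i v >>)
| symZ t i a u : sym_rel (<< upd t i (a *: u) >> - a *: << upd t i u >>)
| symC (t : {ffun 'I_d -> M}) (s : 'S_d) :
    sym_rel (<< [ffun j => t (s j)] : {ffun 'I_d -> M} >> - << t >>).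

Definition Sym : lmodType A := qmod sym_rel.

Definition sym_prod (t : {ffun 'I_d -> M}) : Sym := qclass sym_rel << t >>.

Variable p : nat.

(* Products v ^ p * (t p * ... * t (d - 1)); they generate the image of the
   multiplication map F^p M (x) Sym^(d - p) M -> Sym^d M, where F^p M is the
   A-submodule of Sym^p M generated by the p-th powers.  There are none if
   d < p. *)
Inductive frob_image : Sym -> Prop :=
| FrobImage (v : M) (t : {ffun 'I_d -> M}) :
    (p <= d)%N -> (forall j : 'I_d, (j < p)%N -> t j = v) ->
    frob_image (sym_prod t).

Definition TSym : lmodType A := qmod frob_image.

End SymmetricPowers.

Section SymmetricPowerMaps.
Variables (A B : comNzRingType) (phi : A -> B).
Variables (M : lmodType A) (N : lmodType B) (f : M -> N) (d p : nat).

Definition Sym_map : Sym M d -> Sym N d :=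
  qmod_map (freeg_map phi
    (fun t : {ffun 'I_d -> M} => [ffun j => f (t j)] : {ffun 'I_d -> N})).

Definition TSym_map : TSym M d p -> TSym N d p := qmod_map Sym_map.

End SymmetricPowerMaps.

Arguments TSym_map {A B} phi {M N} f {d p}.

(* Coordinate rings of the intersections of standard affine charts of the
   projective space with homogeneous coordinates 'X_0, ..., 'X_(n-1). *)
Section Charts.
Variables (k : fieldType) (n : nat).

Definition xprod (I : {set 'I_n}) : {mpoly k[n]} := \prod_(i in I) 'X_i.

Lemma xprod_neq0 I : FracField.tofrac (xprod I) != 0.
Proof.
rewrite tofrac_eq0; apply/prodf_neq0 => i _.
by rewrite -msize_poly_eq0 msizeX.
Qed.

Lemma xprod_homog I : xprod I \is [in k[n], #|I|.-homog].
Proof.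
rewrite /xprod -sum1_card; apply: (big_ind2 (fun p m => p \is m.-homog)).
- exact: dhomog1.
- by move=> *; exact: dhomogM.
- by move=> i _; rewrite dhomogX /= mdeg1.
Qed.

(* degree 0 part of k['X_0, ..., 'X_(n-1)][1 / xprod I], inside the fraction
   field *)
Definition in_chart (I : {set 'I_n}) : {pred {fraction {mpoly k[n]}}} :=
  fun f => `[< exists r (g : {mpoly k[n]}), g \is (#|I| * r)%N.-homog /\
                 f = FracField.tofrac g / FracField.tofrac (xprod I) ^+ r >].

Lemma in_chart_closed I : subring_closed (in_chart I).
Proof.
split.
- apply/asboolP; exists 0, 1; rewrite muln0; split; first exact: dhomog1.
  by rewrite expr0 divr1 tofrac1.
- move=> f1 f2 /asboolP [r1 [g1 [h1 ->]]] /asboolP [r2 [g2 [h2 ->]]].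
  apply/asboolP; exists (r1 + r2)%N, (g1 * xprod I ^+ r2 - g2 * xprod I ^+ r1).
  split.
    apply: rpredB; last rewrite addnC; rewrite mulnDr; apply: dhomogM => //;
      exact/dhomogMn/xprod_homog.
  rewrite tofracB !tofracM !tofracXn exprD -[in LHS]mulNr addf_div.
    by rewrite mulNr.
  + exact/expf_neq0/xprod_neq0.
  + exact/expf_neq0/xprod_neq0.
- move=> f1 f2 /asboolP [r1 [g1 [h1 ->]]] /asboolP [r2 [g2 [h2 ->]]].
  apply/asboolP; exists (r1 + r2)%N, (g1 * g2); split.
    by rewrite mulnDr; exact: dhomogM.
  by rewrite tofracM exprD mulf_div.
Qed.

HB.instance Definition _ I := GRing.isSubringClosed.Build
  {fraction {mpoly k[n]}} (in_chart I) (in_chart_closed I).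

Definition chart (I : {set 'I_n}) : Type := {f | f \in in_chart I}.

HB.instance Definition _ I := SubType.on (chart I).
HB.instance Definition _ I := Choice.on (chart I).
HB.instance Definition _ I := [SubChoice_isSubComNzRing of chart I by <:].

Lemma in_chart_const I (c : k) : FracField.tofrac c%:MP \in in_chart I.
Proof.
apply/asboolP; exists 0, c%:MP; rewrite muln0 expr0 divr1; split=> //.
by rewrite -[c%:MP]mulr1 mul_mpolyC; apply/dhomogZ/dhomog1.
Qed.

Lemma in_chart_sub (I J : {set 'I_n}) f :
  I \subset J -> f \in in_chart I -> f \in in_chart J.
Proof.
move=> sIJ /asboolP [r [g [hg ->]]]; apply/asboolP.
have xJ : xprod J = xprod I * xprod (J :\: I).
  by rewrite /xprod (big_setID I) /= (setIidPr sIJ).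
exists r, (g * xprod (J :\: I) ^+ r); split.
  rewrite -(cardsID I J) (setIidPr sIJ) mulnDl.
  by apply: dhomogM => //; exact/dhomogMn/xprod_homog.
by rewrite xJ !tofracM tofracXn exprMn -mulf_div divff ?mulr1 // expf_neq0 //
  xprod_neq0.
Qed.

Definition chart_const I (c : k) : chart I :=
  Sub (FracField.tofrac c%:MP) (in_chart_const I c).

Definition chart_res (I J : {set 'I_n}) (sIJ : I \subset J) (f : chart I) : chart J :=
  Sub (val f) (in_chart_sub sIJ (valP f)).

End Charts.

(* Cech cohomology, for the standard affine cover of P^(n-1), of the
   quasi-coherent sheaf whose sections on D_+(xprod I) are F I.  As the cover
   is affine and P^(n-1) is separated, it is the sheaf cohomology. *)
Section Cech.
Variables (k : fieldType) (n : nat).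
Variable F : forall I : {set 'I_n}, lmodType (chart k I).
Variable res : forall I J : {set 'I_n}, I \subset J -> F I -> F J.

Definition cochain := forall I : {set 'I_n}, F I.

(* degree j: only the (j+1)-fold intersections carry a component *)
Definition in_degree (j : nat) (c : cochain) : Prop :=
  forall I : {set 'I_n}, #|I| != j.+1 -> c I = 0.

Definition cech_diff (c : cochain) : cochain := fun J =>
  \sum_(i in J) (-1) ^+ #|[set l in J | (l < i)%N]| *:
                res (subD1set J i) (c (J :\ i)).

Definition cocycle (j : nat) (c : cochain) : Prop :=
  in_degree j c /\ forall J, cech_diff c J = 0.

Definition coboundary (j : nat) (c : cochain) : Prop :=
  if j is i.+1 then
    exists2 b, in_degree i b & forall J, c J = cech_diff b J
  else forall J, c J = 0.

Definition lin_comb (h : nat) (b : 'I_h -> cochain) (a : {ffun 'I_h -> k}) :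
    cochain :=
  fun J => \sum_(i < h) chart_const J (a i) *: b i J.

(* cocycles modulo coboundaries have a k-basis with h elements *)
Definition cech_dim (j h : nat) : Prop :=
  exists2 b : 'I_h -> cochain, forall i, cocycle j (b i) &
    forall z, cocycle j z ->
      exists! a : {ffun 'I_h -> k},
        coboundary j (fun J => z J - lin_comb b a J).

End Cech.

Section StableCohomology.
Variables (k : fieldType) (p d : nat).

Definition Omega n (I : {set 'I_n}) : lmodType (chart k I) :=
  kaehler (chart_const I).

Definition Omega_res n (I J : {set 'I_n}) (sIJ : I \subset J) :
    Omega I -> Omega J :=
  kaehler_map (chart_res sIJ).

Definition TSymOmega n (I : {set 'I_n}) : lmodType (chart k I) :=
  TSym (Omega I) d p.

Definition TSymOmega_res n (I J : {set 'I_n}) (sIJ : I \subset J) :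
    TSymOmega I -> TSymOmega J :=
  TSym_map (chart_res sIJ) (Omega_res sIJ).

(* h^j(P^(n-1), T_p Sym^d Omega) = h for all n >> 0 *)
Definition hst_TSymOmega (j h : nat) : Prop :=
  exists N, forall n, (N <= n)%N -> cech_dim (@TSymOmega_res n) j h.

End StableCohomology.

(* meaningful for m = 0, 1 modulo p *)
Definition p_index (p m : nat) : nat := (2 * (m %/ p) + m %% p)%N.

(* Main.v *)
Require Import Defs.
From HB Require Import structures.
From mathcomp Require Import all_boot all_order all_fingroup all_algebra.
From mathcomp Require Import generic_quotient fraction.
From mathcomp Require Import boolp.
From mathcomp Require Import freeg mpoly ring.

(**
  Over P^(n-1), the Euler sequence 0 -> Omega -> E = O(-1)^n -> O -> 0 lets one
  contract truncated symmetric powers of E with the Euler vector field.  This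
  gives a derivation D of T_p Sym E with D^p = 0, and Omega = ker(E -> O).
  Locally E = Omega + O e with D e = 1, so that T_p Sym E is
  T_p Sym Omega [e]/(e^p) with D = d/de; hence the complex
    0 -> T_p Sym^d Omega -> T_p Sym^d E -> T_p Sym^(d-1) E
      -> T_p Sym^(d-p) E -> T_p Sym^(d-p-1) E -> ...
  with maps alternately D and D^(p-1) is exact.  For 0 < m < n the sheaf
  T_p Sym^m E is a sum of copies of O(-m) and has no cohomology, so the only
  contribution comes from T_p Sym^0 E = O, which occurs exactly when d = 0, 1
  modulo p, and then in position |d|_p.

  All sections are realised inside the polynomials in the variables e_i = d x_i
  over the field K of rational functions of x_0, ..., x_(n-1); the restriction
  maps then become inclusions.
*)

Set Implicit Arguments.
Unset Strict Implicit.
Unset Printing Implicit Defensive.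

Import GRing.Theory.
Local Open Scope ring_scope.
Local Notation "x %:F" := (FracField.tofrac x).

(** * Cech cohomology of subsheaves of a constant sheaf *)

(** On a chart where x_i is invertible, e = dx_i / x_i, and exactness of the complex is integration
    in e. An antiderivative needs division by 1, ..., p - 1 only, and e^(p-1) has none modulo e^p:
    this obstruction is why D and D^(p-1) alternate. Cut into short exact sequences, the complex
    moves cohomology by one degree per map; two successive maps lower d by p, which is the recursion
    |d|_p = |d - p|_p + 2.

    The bound n > d enters through one count: a Laurent monomial of degree -m with m < n cannot have
    all n exponents negative.

    Sections given as quotients of free modules have no normal form and live over a ring that
    changes with the chart. Inside one polynomial ring a class becomes a truncated polynomial, with
    every monomial having an exponent at least p dropped. The price is a local comparison:
    surjectivity and injectivity of the map are both read off modulo a single variable e_i.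

    The empty index set is formally a chart but not a member of the cover. Local statements are
    therefore restricted to nonempty sets, and cochains vanish on the empty one. *)

Section Simplex.
Variables (K : pzRingType) (W : lmodType K) (n : nat).
Implicit Types (I J : {set 'I_n}) (c b : {set 'I_n} -> W).

Definition rank_in J (i : 'I_n) : nat := #|[set l in J | (l < i)%N]|.

Lemma rank_inD1 J (i l : 'I_n) : l \in J ->
  rank_in J i = ((l < i) + rank_in (J :\ l) i)%N.
Proof.
move=> lJ; rewrite /rank_in (cardsD1 l) inE lJ /=; congr (_ + #|pred_of_set _|)%N.
by apply/setP=> x; rewrite !inE andbA.
Qed.

Definition delta c J : W := \sum_(i in J) (-1) ^+ rank_in J i *: c (J :\ i).

Lemma eq_delta c b : c =1 b -> delta c =1 delta b.
Proof. by move=> e J; apply: eq_bigr => i _; rewrite e. Qed.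

Lemma deltaD c b J : delta (fun I => c I + b I) J = delta c J + delta b J.
Proof. by rewrite -big_split; apply: eq_bigr => i _; rewrite scalerDr. Qed.

Lemma deltaN c J : delta (fun I => - c I) J = - delta c J.
Proof. by rewrite -sumrN; apply: eq_bigr => i _; rewrite scalerN. Qed.

Lemma deltaB c b J : delta (fun I => c I - b I) J = delta c J - delta b J.
Proof. by rewrite deltaD deltaN. Qed.

Lemma delta_sum h (c : 'I_h -> {set 'I_n} -> W) J :
  delta (fun I => \sum_i c i I) J = \sum_i delta (c i) J.
Proof.
rewrite exchange_big /=; apply: eq_bigr => i _; exact: scaler_sumr.
Qed.

Lemma delta0 c J : (forall I, c I = 0) -> delta c J = 0.
Proof. by move=> c0; apply: big1 => i _; rewrite c0 scaler0. Qed.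

Lemma delta_delta c J : delta (delta c) J = 0.
Proof.
pose t (i l : 'I_n) := (-1) ^+ (rank_in J i + rank_in (J :\ i) l) *: c (J :\ i :\ l).
pose P (x : 'I_n * 'I_n) := [&& x.1 \in J, x.2 \in J & x.1 != x.2].
have -> : delta (delta c) J = \sum_(x | P x) t x.1 x.2.
  rewrite /delta (eq_bigr (fun i => \sum_(l in J :\ i) t i l)); last first.
    by move=> i _; rewrite scaler_sumr; apply: eq_bigr => l _; rewrite scalerA -exprD.
  rewrite pair_big_dep /=; apply: eq_bigl => -[i l].
  by rewrite /P !inE /= [l == i]eq_sym; case: (i \in J); rewrite //= andbC.
rewrite (bigID (fun x : 'I_n * 'I_n => (x.1 < x.2)%N)) /=.
(* Exchanging the two removed indices matches the pairs with [i < l] with the remaining ones and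
   reverses the sign. *)
pose sw (x : 'I_n * 'I_n) := (x.2, x.1).
rewrite [X in _ + X](reindex_onto sw sw) /=; last by case.
set A := BIG_F.
rewrite [X in _ + X](eq_big (fun x => P x && (x.1 < x.2)%N) (fun x => - A x)).
- by rewrite sumrN subrr.
- move=> [i l]; rewrite /P /sw /= eqxx andbT andbCA eq_sym -leqNgt leq_eqVlt -val_eqE /=.
  by case: eqVneq => //=; rewrite ?andbF //.
move=> [i l] /= /andP [/andP [/and3P [/= lJ iJ nil] ]].
rewrite -leqNgt leq_eqVlt val_eqE eq_sym (negPf nil) /= => ltil _.
rewrite /A /t /= !setDDl [[set l; i]]setUC -scaleNr; congr (_ *: _).
rewrite (rank_inD1 l iJ) ltil (rank_inD1 i lJ) ltnNge (ltnW ltil) /= add0n add1n.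
by rewrite addSn exprS mulN1r addnC.
Qed.

Definition cone (i0 : 'I_n) c I : W :=
  if i0 \in I then 0 else (-1) ^+ rank_in (i0 |: I) i0 *: c (i0 |: I).

Lemma delta_cone i0 c J : (forall I, delta c I = 0) ->
  delta (cone i0 c) J = c J.
Proof.
move=> dc0; have sq m : (-1) ^+ m * (-1) ^+ m = 1 :> K by rewrite -expr2 sqrr_sign.
have [iJ|niJ] := boolP (i0 \in J).
  rewrite /delta (big_setD1 i0) //= big1 => [|i]; last first.
    by rewrite 2!inE => /andP [ni iJ']; rewrite /cone !inE eq_sym ni iJ /= scaler0.
  by rewrite /cone !inE eqxx /= setD1K // addr0 scalerA sq scale1r.
(* The cocycle condition on [i0 |: J] expresses [c J] through the faces that contain [i0], which are
   the values entering the cone. *)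
have := dc0 (i0 |: J); rewrite /delta (big_setD1 i0) /= ?setU11 //.
rewrite setU1K // => /eqP; rewrite addr_eq0 => /eqP e.
have -> : c J = (-1) ^+ rank_in (i0 |: J) i0 *: ((-1) ^+ rank_in (i0 |: J) i0 *: c J).
  by rewrite scalerA sq scale1r.
rewrite e scalerN scaler_sumr -sumrN.
apply: eq_bigr => i iJ; have ni : i0 != i by apply: contraNneq niJ => ->.
rewrite /cone !inE (negPf niJ) andbF.
have -> : i0 |: J :\ i = (i0 |: J) :\ i.
  apply/setP=> x; rewrite !inE; case: (eqVneq x i0) => [->|//].
  by rewrite ni.
rewrite !scalerA -scaleNr; congr (_ *: _); rewrite -!exprD.
have iJ' : i \in i0 |: J by rewrite inE iJ orbT.
rewrite (@rank_inD1 (i0 |: J) i i0) ?setU11 // setU1K //.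
rewrite (@rank_inD1 (i0 |: J) i0 i) //.
rewrite -[RHS]mulN1r -exprS -[LHS]signr_odd -[RHS]signr_odd /= !oddD !oddb.
move: ni; rewrite -val_eqE /= neq_ltn => /orP [] lt; rewrite lt ltnNge (ltnW lt) /=;
  by do 2! case: (odd _).
Qed.

End Simplex.

(** * Cohomology of families of subspaces and dimension shifting *)

Section CechDim.
Variables (k : fieldType) (K : nzRingType) (iota : {rmorphism k -> K}).
Variables (W : lmodType K) (n : nat).
Implicit Types (M : {set 'I_n} -> W -> Prop) (c b : {set 'I_n} -> W).

(** Only scalars from [k] are required: they are common to all charts, and cohomology is taken over
    [k]. *)
Definition submodules M := forall I, M I 0 /\
  (forall u v, M I u -> M I v -> M I (u + v)) /\
  (forall (a : k) v, M I v -> M I (iota a *: v)).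

Definition monotone M := forall (I J : {set 'I_n}) u, I \subset J -> M I u -> M J u.

Definition coch M j c :=
  forall I, M I (c I) /\ (#|I| != j.+1 -> c I = 0).

Definition cocyc M j c := coch M j c /\ forall J, delta c J = 0.

Definition cobound M j c :=
  if j is i.+1 then exists2 b, coch M i b & forall J, c J = delta b J
  else forall J, c J = 0.

Definition comb h (b : 'I_h -> {set 'I_n} -> W) (a : {ffun 'I_h -> k}) J : W :=
  \sum_i iota (a i) *: b i J.

Definition cohdim M j h :=
  exists2 b : 'I_h -> {set 'I_n} -> W, forall i, cocyc M j (b i) &
    forall z, cocyc M j z ->
      exists! a : {ffun 'I_h -> k}, cobound M j (fun J => z J - comb b a J).

Lemma cohdim0P M j : (forall z, cocyc M j z -> cobound M j z) -> cohdim M j 0.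
Proof.
move=> H; exists (fun _ _ => 0) => [[]//|z zz].
have e a : (fun J => z J - comb (fun (_ : 'I_0) _ => 0) a J) = z.
  by apply/funext => J; rewrite /comb big_ord0 subr0.
exists [ffun=> 0]; split=> [|a' _]; first by rewrite e; exact: H.
by apply/ffunP => -[].
Qed.

Lemma cohdim0E M j z : cohdim M j 0 -> cocyc M j z -> cobound M j z.
Proof.
move=> [b _ H] /H [a [+ _]]; congr cobound.
by apply/funext => J; rewrite /comb big_ord0 subr0.
Qed.

Section Closure.
Variable M : {set 'I_n} -> W -> Prop.
Hypotheses (smM : submodules M) (mM : monotone M).

Lemma submod0 I : M I 0. Proof. by case: (smM I). Qed.

Lemma submodD I u v : M I u -> M I v -> M I (u + v).
Proof. by case: (smM I) => _ [+ _]; apply. Qed.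

Lemma submodZ I a v : M I v -> M I (iota a *: v).
Proof. by case: (smM I) => _ [_ +]; apply. Qed.

Lemma submodN I v : M I v -> M I (- v).
Proof. by move=> Mv; rewrite -scaleN1r -(rmorphN1 iota); exact: submodZ. Qed.

Lemma submodB I u v : M I u -> M I v -> M I (u - v).
Proof. by move=> Mu Mv; apply/submodD/submodN. Qed.

Lemma submod_sum I T (r : seq T) (P : pred T) (F : T -> W) :
  (forall i, P i -> M I (F i)) -> M I (\sum_(i <- r | P i) F i).
Proof. by move=> MF; apply: big_ind => //; [exact: submod0|exact: submodD]. Qed.

Lemma cochB j c b : coch M j c -> coch M j b -> coch M j (fun J => c J - b J).
Proof.
move=> Mc Mb I; split; first by apply: submodB; [exact: (Mc I).1|exact: (Mb I).1].
by move=> nI; rewrite (Mc I).2 // (Mb I).2 // subrr.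
Qed.

Lemma coch_comb j h (b : 'I_h -> {set 'I_n} -> W) a :
  (forall i, coch M j (b i)) -> coch M j (comb b a).
Proof.
move=> Mb I; split; first by apply: submod_sum => i _; apply/submodZ/(Mb i I).1.
by move=> nI; apply: big1 => i _; rewrite (Mb i I).2 // scaler0.
Qed.

Lemma coch_delta j c : coch M j c -> coch M j.+1 (delta c).
Proof.
move=> Mc I; split.
  apply: submod_sum => i iI; rewrite -signr_odd -(rmorph_sign iota).
  apply/submodZ/(mM (subD1set I i))/(Mc _).1.
move=> nI; apply: big1 => i iI; rewrite (Mc _).2 ?scaler0 //.
by move: nI; rewrite (cardsD1 i) iI.
Qed.

End Closure.

Lemma coch0 M j c : coch M j c -> c set0 = 0.
Proof. by case/(_ set0) => _; rewrite cards0; apply. Qed.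

(** Cochains are supported on sets of [j.+1] elements, so the values of [M] on the empty set never
    enter. *)
Lemma cohdim_eq M M' j h : submodules M -> submodules M' ->
  (forall I u, I != set0 -> M I u <-> M' I u) -> cohdim M j h -> cohdim M' j h.
Proof.
move=> sM sM' eM.
have ec i c : coch M i c <-> coch M' i c.
  split=> Mc I; (split; last exact: (Mc I).2).
    have [->|I0] := eqVneq I set0; last exact/(eM _ _ I0)/(Mc I).1.
    by rewrite (coch0 Mc); exact: submod0 sM' _.
  have [->|I0] := eqVneq I set0; last exact/(eM _ _ I0)/(Mc I).1.
  by rewrite (coch0 Mc); exact: submod0 sM _.
have ez i c : cocyc M i c <-> cocyc M' i c by rewrite /cocyc ec.
have eb i c : cobound M i c <-> cobound M' i c.
  by case: i => //= i; split=> -[b /ec Mb e]; exists b.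
move=> [b Hb Hz]; exists b => [i|z /ez /Hz [a [az au]]]; first exact/ez.
by exists a; split=> [|a' /eb]; [exact/eb|exact: au].
Qed.


(* Dimension shifting along 0 -> M' -> M -> M'' -> 0, exact on nonempty sets. *)
Section Shift.
Variables (M' M M'' : {set 'I_n} -> W -> Prop) (D : {linear W -> W}).
Hypotheses (sM' : submodules M') (sM : submodules M) (mM : monotone M).
Hypothesis kerD : forall I u, I != set0 -> M' I u <-> M I u /\ D u = 0.
Hypothesis imD : forall I u, M I u -> M'' I (D u).
Hypothesis surjD : forall I v, I != set0 -> M'' I v -> exists2 u, M I u & D u = v.

Let D_delta c J : D (delta c J) = delta (D \o c) J.
Proof.
rewrite linear_sum; apply: eq_bigr => i _; exact: linearZ.
Qed.

Let coch_ker j c : coch M' j c <-> coch M j c /\ forall I, D (c I) = 0.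
Proof.
split=> [Mc|[Mc Dc] I].
  have H I : M I (c I) /\ D (c I) = 0.
    have [->|I0] := eqVneq I set0; last exact/(kerD _ I0)/(Mc I).1.
    by rewrite (coch0 Mc) linear0; split=> //; exact: submod0 sM _.
  split=> I; last by case: (H I).
  by split; [case: (H I)|exact: (Mc I).2].
split; last exact: (Mc I).2.
have [->|I0] := eqVneq I set0; last by apply/(kerD _ I0); case: (Mc I).
by rewrite (coch0 Mc); exact: submod0 sM' _.
Qed.

Let coch_im j c : coch M j c -> coch M'' j (D \o c).
Proof.
move=> Mc I; split; first exact/imD/(Mc I).1.
by move=> nI /=; rewrite (Mc I).2 // linear0.
Qed.

Let coch_surj j c : coch M'' j c -> exists2 b, coch M j b & forall I, D (b I) = c I.
Proof.
move=> Mc.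
have H I : exists u, [/\ M I u, D u = c I & (#|I| != j.+1 -> u = 0)].
  have [eI|nI] := eqVneq #|I| j.+1; last first.
    by exists 0; split=> //; [exact: submod0 sM _|rewrite linear0 (Mc I).2].
  have I0 : I != set0 by rewrite -card_gt0 eI.
  by have [u Mu Du] := surjD I0 (Mc I).1; exists u.
exists (fun I => projT1 (cid (H I))) => I; by case: (cid (H I)) => u [].
Qed.

Lemma cohdim_shift0 : cohdim M 0 0 -> cohdim M' 0 0.
Proof.
move=> H; apply: cohdim0P => z [/coch_ker [Mz _] dz].
by apply: (cohdim0E H).
Qed.

(** The connecting map is an isomorphism because [M] has no cohomology in the two degrees around it.
    A basis of the target is obtained by lifting the representatives along [D] and applying
    [delta]. *)
Lemma cohdim_shift j h : cohdim M j 0 -> cohdim M j.+1 0 ->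
  cohdim M'' j h -> cohdim M' j.+1 h.
Proof.
move=> Hj Hj1 [b'' zb'' Hb''].
have /all_sig2 : forall i, {b | coch M j b & forall I, D (b I) = b'' i I}.
  by move=> i; apply/cid2/coch_surj/(zb'' i).1.
case=> b Mb Db.
have delta_comb a J : delta (comb b a) J = comb (fun i => delta (b i)) a J.
  rewrite /comb delta_sum; apply: eq_bigr => i _.
  rewrite /delta scaler_sumr; apply: eq_bigr => l _.
  by rewrite !scalerA -signr_odd -(rmorph_sign iota) -!rmorphM mulrC.
have D_comb a J : D (comb b a J) = comb b'' a J.
  by rewrite linear_sum; apply: eq_bigr => i _; rewrite linearZ /= Db.
exists (fun i => delta (b i)) => [i|z [/coch_ker [Mz Dz] dz]].
  split=> [|J]; last exact: delta_delta.
  apply/coch_ker; split=> [|I]; first exact: (coch_delta sM mM).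
  by rewrite D_delta (eq_delta (Db i)) (zb'' i).2.
have [y My zy] : cobound M j.+1 z by apply: (cohdim0E Hj1).
have zDy : cocyc M'' j (D \o y).
  split=> [|J]; first exact: coch_im.
  by rewrite -D_delta -zy Dz.
have E a : cobound M' j.+1 (fun J => z J - comb (fun i => delta (b i)) a J) <->
           cobound M'' j (fun J => D (y J) - comb b'' a J).
  have Myb : coch M j (fun J => y J - comb b a J).
    by apply: (cochB sM) => //; exact: (coch_comb sM).
  split=> [[v /coch_ker [Mv Dv] ev]|].
    (* The two primitives of the same cochain differ by a cocycle of [M], hence by a coboundary;
       applying [D] removes [v] and leaves the required relation in [M'']. In degree 0 the
       coboundary is zero. *)
    have /(cohdim0E Hj) : cocyc M j (fun J => y J - comb b a J - v J).
      split=> [|J]; first exact: (cochB sM).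
      by rewrite 2!deltaB -zy delta_comb ev subrr.
    case: (j) => [/= e J|i /= [t Mt e]].
      move/(congr1 D): (e J); rewrite !linearB /= linear0 Dv D_comb.
      by rewrite subr0.
    exists (D \o t) => [|J]; first exact: coch_im.
    by rewrite -D_delta -e !linearB /= Dv D_comb subr0.
  case: (j) Myb => [|i] Myb /= e.
    exists (fun J => y J - comb b a J).
      by apply/coch_ker; split=> // I; rewrite linearB /= D_comb.
    by move=> J; rewrite deltaB -zy delta_comb.
  have [t'' Mt'' et''] := e; have [t Mt et] := coch_surj Mt''.
  exists (fun J => y J - comb b a J - delta t J) => [|J].
    apply/coch_ker; split=> [|I].
      by apply: (cochB sM) => //; exact: (coch_delta sM mM).
    by rewrite !linearB /= D_delta (eq_delta et) D_comb et'' subrr.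
  by rewrite 2!deltaB delta_delta subr0 -zy delta_comb.
have [a [az au]] := Hb'' _ zDy; exists a; split; first exact/E.
by move=> a' /E /au.
Qed.

End Shift.

End CechDim.

(** * Graded localizations and the cohomology of O(-q) *)

Section Localization.
Variables (k : fieldType) (n : nat).
Local Notation S := {mpoly k[n]}.
Local Notation K := {fraction {mpoly k[n]}}.
Implicit Types (I J : {set 'I_n}) (m : 'X_{1..n}) (r : int) (f g : K).

Definition kconst (c : k) : K := (c%:MP : S)%:F.
HB.instance Definition _ := GRing.RMorphism.copy kconst
  (@FracField.tofrac S \o @mpolyC n k).

Definition mset J s : 'X_{1..n} := [multinom (if i \in J then s else 0)%N | i < n].

Lemma msetE J s i : mset J s i = if i \in J then s else 0%N.
Proof. exact: mnmE. Qed.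

Lemma mdeg_mset J s : mdeg (mset J s) = (#|J| * s)%N.
Proof.
rewrite mdegE (eq_bigr (fun i => if i \in J then s else 0%N)) => [|i _]; last exact: msetE.
by rewrite -big_mkcond sum_nat_const.
Qed.

Lemma xprodX J s : xprod k J ^+ s = 'X_[mset J s].
Proof.
rewrite /xprod mprodXE mpolyXn; congr 'X_[_]; apply/mnmP => i.
rewrite mulmnE msetE mnm_sumE (eq_bigr (fun l => (l == i) : nat)) => [|l _]; last exact: mnm1E.
rewrite -big_mkcondr sum1dep_card /=.
have [iJ|niJ] := boolP (i \in J).
  rewrite (_ : [set x | _] = [set i]) ?cards1 ?mul1n //.
  by apply/setP=> x; rewrite !inE andbC; case: eqP => // ->.
rewrite (_ : [set x | _] = set0) ?cards0 //.
by apply/setP=> x; rewrite !inE andbC; case: eqP => // ->; exact: negPf.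
Qed.

Definition den s : K := ('X_[mset setT s] : S)%:F.

Lemma den_neq0 s : den s != 0.
Proof. by rewrite /den -xprodX tofracXn expf_neq0 // xprod_neq0. Qed.

Lemma denD s t : den (s + t) = den s * den t.
Proof. by rewrite /den -!xprodX exprD tofracM. Qed.

(** Numerators over [den s], whose degree is [n * s]: exponents at least [s] off [I] cancel the
    denominator there, so only variables indexed by [I] are inverted. *)
Definition num_deg I r s (g : S) := forall m, m \in msupp g ->
  (mdeg m)%:Z = (n * s)%:Z + r /\ forall i, i \notin I -> (s <= m i)%N.

(* The degree r part of k['X_0, ..., 'X_(n-1)][1 / xprod I]; the denominator
   is a power of the product of all variables, which all charts share. *)
Definition loc I r (f : K) :=
  exists s (g : S), num_deg I r s g /\ f = g%:F / den s.

Lemma num_degMX I r s t (g : S) : num_deg I r s g ->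
  num_deg I r (s + t) (g * 'X_[mset setT t]).
Proof.
move=> gd m; rewrite (perm_mem (msuppMX _ _)) => /mapP [m' /gd [dm' m's] ->].
split=> [|i /m's si]; last by rewrite mnmDE msetE inE addnC leq_add2l.
by rewrite mdegD mdeg_mset cardsT card_ord mulnDr !PoszD dm' addrCA addrA.
Qed.

Lemma loc_raise I r s t (g : S) : num_deg I r s g -> (s <= t)%N ->
  exists2 h : S, num_deg I r t h & h%:F / den t = g%:F / den s.
Proof.
move=> gd st; exists (g * 'X_[mset setT (t - s)]).
  by rewrite -{1}(subnKC st); exact: num_degMX.
rewrite -{2}(subnKC st) denD tofracM -/(den _) -mulf_div divff ?mulr1 //.
exact: den_neq0.
Qed.

Lemma num_degD I r s (g h : S) : num_deg I r s g -> num_deg I r s h ->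
  num_deg I r s (g + h).
Proof.
by move=> gd hd m /msuppD_le; rewrite mem_cat => /orP [/gd|/hd].
Qed.

Lemma num_degM I r r' s s' (g h : S) : num_deg I r s g -> num_deg I r' s' h ->
  num_deg I (r + r') (s + s') (g * h).
Proof.
move=> gd hd m /msuppM_le /allpairsP [[m1 m2] /= [/gd [d1 h1] /hd [d2 h2] ->]].
split=> [|i iI]; last by rewrite mnmDE leq_add ?h1 ?h2.
by rewrite mdegD mulnDr !PoszD d1 d2 addrACA.
Qed.

Lemma loc0 I r : loc I r 0.
Proof.
exists 0%N, 0; split; last by rewrite tofrac0 mul0r.
by move=> m; rewrite (msupp0 n k).
Qed.

Lemma locD I r f g : loc I r f -> loc I r g -> loc I r (f + g).
Proof.
move=> [s [a [ad ->]]] [t [b [bd ->]]].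
have [a' ad' <-] := loc_raise ad (leq_addr t s).
have [b' bd' <-] := loc_raise bd (leq_addl s t).
exists (s + t)%N, (a' + b'); split; first exact: num_degD.
by rewrite tofracD mulrDl.
Qed.

Lemma locM I r r' f g : loc I r f -> loc I r' g -> loc I (r + r') (f * g).
Proof.
move=> [s [a [ad ->]]] [t [b [bd ->]]]; exists (s + t)%N, (a * b).
split; first exact: num_degM.
by rewrite tofracM denD mulf_div.
Qed.

Lemma loc_mono I J r f : I \subset J -> loc I r f -> loc J r f.
Proof.
move=> sIJ [s [g [gd ->]]]; exists s, g; split=> // m /gd [dm hm].
split=> // i iJ; apply: hm; apply: contra iJ; exact: (subsetP sIJ).
Qed.

Lemma loc_kconst I c : loc I 0 (kconst c).
Proof.
exists 0%N, c%:MP; split=> [m|].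
  rewrite msuppC; case: eqP => // _; rewrite inE => /eqP ->.
  by split=> [|//]; rewrite mdeg0 muln0.
have -> : den 0 = 1 by rewrite /den -xprodX expr0 tofrac1.
by rewrite divr1.
Qed.

Lemma locZ I r c f : loc I r f -> loc I r (kconst c * f).
Proof. by move=> lf; rewrite -[r]add0r; apply/locM/lf/loc_kconst. Qed.

Lemma locN I r f : loc I r f -> loc I r (- f).
Proof. by move=> /(locZ (-1)); rewrite rmorphN1 mulN1r. Qed.

Lemma loc_sum I r T (l : seq T) (P : pred T) (F : T -> K) :
  (forall i, P i -> loc I r (F i)) -> loc I r (\sum_(i <- l | P i) F i).
Proof. by move=> MF; apply: big_ind => //; [exact: loc0|exact: locD]. Qed.

Definition hcoord (i : 'I_n) : K := ('X_i : S)%:F.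

Lemma hcoord_neq0 i : hcoord i != 0.
Proof. by rewrite tofrac_eq0 -msize_poly_eq0 msizeX. Qed.

Lemma loc_hcoord I i : loc I 1 (hcoord i).
Proof.
exists 0%N, 'X_i; split=> [m|].
  by rewrite msuppX inE => /eqP ->; rewrite mdeg1 muln0.
have -> : den 0 = 1 by rewrite /den -xprodX expr0 tofrac1.
by rewrite divr1.
Qed.

Lemma loc_Vhcoord I i : i \in I -> loc I (-1) (hcoord i)^-1.
Proof.
move=> iI; have U1 : (U_(i) <= mset setT 1)%MM by rewrite lep1mP msetE inE.
exists 1%N, 'X_[mset setT 1 - U_(i)]; split=> [m|].
  rewrite msuppX inE => /eqP ->; split.
    have := congr1 mdeg (submK U1); rewrite mdegD mdeg1 mdeg_mset cardsT card_ord.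
    by move=> <-; rewrite PoszD addrK.
  by move=> l lI; rewrite mnmBE msetE mnm1E inE; case: eqP => // e; rewrite -e iI in lI.
apply: (mulIf (den_neq0 1)); rewrite divfK ?den_neq0 //.
by rewrite /den -{1}(submK U1) mpolyXD tofracM mulrC mulfK // hcoord_neq0.
Qed.

(** The two denominators differ by the [s]-th power of the product of the variables outside [I],
    which divides every admissible numerator. *)
Lemma loc_chart I f : f \in in_chart I <-> loc I 0 f.
Proof.
have e s : den s = (xprod k I)%:F ^+ s * ('X_[mset (~: I) s] : S)%:F.
  rewrite /den -tofracXn xprodX -tofracM -mpolyXD; congr (tofrac 'X_[_]).
  apply/mnmP=> i; rewrite mnmDE !msetE !inE; case: (i \in I); by rewrite ?addn0.
have nz J s : ('X_[mset J s] : S)%:F != 0.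
  by rewrite -xprodX tofracXn expf_neq0 // xprod_neq0.
split=> [/asboolP [s [g [gh ->]]]|[s [g [gd ->]]]].
  exists s, (g * 'X_[mset (~: I) s]); split=> [m|].
    rewrite (perm_mem (msuppMX _ _)) => /mapP [m' m'g ->].
    rewrite mdegD mdeg_mset (dhomogP _ _ _ gh _ m'g) -mulnDl addnC cardsC card_ord addr0.
    split=> // i iI; rewrite mnmDE msetE inE iI; exact: leq_addr.
  by rewrite e tofracM -mulf_div divff ?mulr1.
rewrite [g]mpolyE raddf_sum mulr_suml big_seq; apply: rpred_sum => m mg.
have [dm hm] := gd _ mg; rewrite addr0 in dm; case: dm => dm.
have le : (mset (~: I) s <= m)%MM.
  by apply/mnm_lepP=> i; rewrite msetE inE; case: ifP => // /hm.
apply/asboolP; exists s, (g@_m *: 'X_[m - mset (~: I) s]); split.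
  apply: dhomogZ; rewrite dhomogX /=; apply/eqP.
  have en : (n * s = #|I| * s + #|~: I| * s)%N by rewrite -mulnDl cardsC card_ord.
  by have := congr1 mdeg (submK le); rewrite mdegD dm mdeg_mset en => /addIn.
have -> : 'X_[m] = 'X_[m - mset (~: I) s] * 'X_[mset (~: I) s] :> S.
  by rewrite -mpolyXD submK.
by rewrite /= e mpoly_scaleAl tofracM -mulf_div divff ?mulr1.
Qed.

(** Nothing is inverted on the empty set, so these are polynomials of degree [r], and [r] is not
    positive. *)
Lemma loc_set0 r f : (r <= 0)%R -> loc set0 r f ->
  f = 0 \/ r = 0 /\ exists c, f = kconst c.
Proof.
move=> r0 [s [g [gd ->]]].
have gm m : m \in msupp g -> m = mset setT s /\ r = 0.
  move=> /gd [dm hm]; pose m' := (m - mset setT s)%MM.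
  have em : m = (m' + mset setT s)%MM.
    by rewrite submK //; apply/mnm_lepP=> i; rewrite msetE inE hm ?inE.
  move: dm; rewrite em mdegD mdeg_mset cardsT card_ord PoszD addrC => /addrI e.
  move: r0; rewrite -e lez_nat leqn0 mdeg_eq0 => /eqP ->.
  by rewrite add0m mdeg0.
case: (msupp g =P [::]) => [/msuppnil0 ->|/eqP]; first by left; rewrite tofrac0 mul0r.
case e : (msupp g) => [//|m l] _; have /gm [_ ->] : m \in msupp g by rewrite e mem_head.
right; split=> //; exists (g@_(mset setT s)).
apply: (mulIf (den_neq0 s)); rewrite divfK ?den_neq0 // /kconst /den -tofracM mul_mpolyC.
congr tofrac; apply/mpolyP => m'; rewrite mcoeffZ mcoeffX.
case: eqP => [<-|ne]; first by rewrite mulr1.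
rewrite mulr0; apply: memN_msupp_eq0; apply/negP=> /gm [] /esym //.
Qed.

Lemma tofrac_delta (g : {set 'I_n} -> S) s J :
  (delta g J)%:F / den s = delta (fun I => (g I)%:F / den s : K^o) J.
Proof.
rewrite raddf_sum mulr_suml; apply: eq_bigr => i _ /=.
by rewrite -mul_mpolyC tofracM -mulrA -signr_odd -/(kconst _) rmorph_sign signr_odd.
Qed.

Lemma mcoeff_delta (R : nzRingType) (g : {set 'I_n} -> {mpoly R[n]}) m J :
  (delta g J)@_m = delta (fun I => (g I)@_m : R^o) J.
Proof.
by rewrite raddf_sum; apply: eq_bigr => i _ /=; rewrite mcoeffZ.
Qed.

Lemma mcoeff_bsum (R : nzRingType) B (F : 'X_{1..n} -> R) m :
  (\sum_(m' : 'X_{1..n < B}) F m' *: 'X_[m'])@_m = if (mdeg m < B)%N then F m else 0.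
Proof.
case: ltnP => mB; first exact: mcoeff_mpoly.
rewrite raddf_sum big1 //= => m' _; rewrite mcoeffZ mcoeffX.
by case: eqP => [e|]; rewrite ?mulr0 //; have := bmdeg m'; rewrite e ltnNge mB.
Qed.

(* Monomial by monomial: a monomial of degree n * s - q with q < n has some
   exponent at least s, and contracting with that variable keeps the
   numerator admissible. *)
Lemma loc_cocycle (q j : nat) (z : {set 'I_n} -> K^o) :
  (q < n)%N -> cocyc (W := K^o) (fun I => loc I (- q%:Z)) j z ->
  exists t : {set 'I_n} -> K^o,
    [/\ forall I, loc I (- q%:Z) (t I), forall I, #|I| != j -> t I = 0 &
        forall J, z J = delta t J].
Proof.
move=> qn [Mz dz].
have /all_sig [sg hsg] : forall I, {s | exists g : S,
    num_deg I (- q%:Z) s g /\ z I = g%:F / den s}.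
  by move=> I; exact/cid/(Mz I).1.
pose s := (\max_I sg I)%N.
have /all_sig2 [g gd zg] : forall I,
    {g : S | num_deg I (- q%:Z) s g & g%:F / den s = z I}.
  move=> I; apply/cid2; have [g [gd ->]] := hsg I.
  exact/loc_raise/(leq_bigmax I).
have gN I : #|I| != j.+1 -> g I = 0.
  move=> /(Mz I).2; rewrite -zg => /eqP.
  by rewrite mulf_eq0 invr_eq0 (negPf (den_neq0 s)) orbF tofrac_eq0 => /eqP.
have dg J : delta g J = 0.
  apply/eqP; rewrite -tofrac_eq0 -(inj_eq (mulIf (invr_neq0 (den_neq0 s)))) mul0r.
  by rewrite tofrac_delta (_ : (fun I => _) = z) ?dz //; apply/funext.
pose i1 := Ordinal (leq_ltn_trans (leq0n q) qn).
(* The vertex depends on the monomial only, so for each coefficient the cone is taken at one fixed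
   vertex. By [pkP] the default [i1] is not reached in the relevant degree. *)
pose pk (m : 'X_{1..n}) := odflt i1 [pick i | (s <= m i)%N].
have pkP m : ((mdeg m)%:Z = (n * s)%:Z - q%:Z) -> (s <= m (pk m))%N.
  rewrite /pk; case: pickP => //= nm /(congr1 (+%R^~ q%:Z)); rewrite subrK -PoszD.
  case=> e; suff : (mdeg m + n <= n * s)%N by rewrite -e leq_add2l leqNgt qn.
  apply: (@leq_trans (\sum_(i < n) (m i + 1))%N).
    by rewrite big_split /= sum1_card card_ord mdegE.
  apply: (@leq_trans (\sum_(i < n) s)%N); last by rewrite sum_nat_const card_ord.
  by apply: leq_sum => i _; rewrite addn1 ltnNge nm.
pose cf m I := cone (pk m) (fun I => (g I)@_m : k^o) I.
(* Monomials of the numerators have degree [n * s - q], so this bound loses none of them. *)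
pose b I : S := \sum_(m : 'X_{1..n < (n * s).+1}) cf m I *: 'X_[m].
have bE I m : (b I)@_m = cf m I.
  rewrite (mcoeff_bsum _ (cf^~ I)); case: ltnP => // mb.
  have g0 J : (g J)@_m = 0.
    apply: memN_msupp_eq0; apply/negP=> /gd [+ _].
    move=> /(congr1 (+%R^~ q%:Z)); rewrite subrK -PoszD => -[e].
    by move: mb; rewrite -e ltnNge leq_addr.
  by rewrite /cf /cone g0 scaler0 if_same.
exists (fun I => (b I)%:F / den s); split=> [I|I nI|J].
- exists s, (b I); split=> // m; rewrite mcoeff_msupp bE /cf /cone.
  case: ifP => [_ /eqP //|/negbT pI nz].
  have /gd [dm hm] : m \in msupp (g (pk m |: I)).
    by rewrite mcoeff_msupp; apply: contraNneq nz => ->; rewrite scaler0.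
  split=> // i iI; have [->|ni] := eqVneq i (pk m); first exact: pkP.
  by apply: hm; rewrite !inE negb_or ni.
- suff -> : b I = 0 by rewrite tofrac0 mul0r.
  apply/mpolyP=> m; rewrite bE mcoeff0 /cf /cone; case: ifP => // /negbT pI.
  by rewrite gN ?mcoeff0 ?scaler0 // cardsU1 pI.
rewrite -tofrac_delta -zg; congr (_%:F / _); apply/mpolyP=> m.
rewrite mcoeff_delta (_ : (fun I => _) = cf m); last exact/funext.
rewrite delta_cone // => I.
by rewrite -mcoeff_delta dg mcoeff0.
Qed.

End Localization.

(** * The truncated Koszul complex *)

Section LeibnizPower.
Variables (R : comNzRingType) (D : {additive R -> R}).
Hypothesis DM : forall u v, D (u * v) = D u * v + u * D v.

Lemma iter_add s (u v : R) : iter s D (u + v) = iter s D u + iter s D v.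
Proof. by elim: s => //= s ->; exact: raddfD. Qed.

Lemma iter_leibniz s (u v : R) :
  iter s D (u * v) = \sum_(i < s.+1) (iter (s - i) D u * iter i D v) *+ 'C(s, i).
Proof.
elim: s => [|s IHs]; first by rewrite big_ord1.
rewrite iterS IHs raddf_sum /=.
rewrite (eq_bigr (fun i : 'I_s.+1 => (iter (s - i).+1 D u * iter i D v) *+ 'C(s, i) +
   (iter (s - i) D u * iter i.+1 D v) *+ 'C(s, i))); last first.
  by move=> i _; rewrite raddfMn DM mulrnDl.
rewrite big_split /= [in RHS]big_ord_recl /= bin0.
rewrite big_ord_recl /= bin0 ?subn0 -addrA; congr (_ + _).
rewrite [in X in _ + X]big_ord_recr /= [in RHS]big_ord_recr /= !subnn !binn addrA.
congr (_ + _); rewrite -big_split /=; apply: eq_bigr => i _.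
rewrite /bump /= !add1n binS mulrnDr subSS; congr (_ *+ _ + _).
by rewrite -iterS subnSK.
Qed.

(** All middle binomial coefficients are divisible by [p], so the [p]-th iterate of a derivation is
    again a derivation. *)
Lemma iter_pchar_leibniz p (u v : R) : p \in [pchar R] ->
  iter p D (u * v) = iter p D u * v + u * iter p D v.
Proof.
move=> pcR; have p_pr := pcharf_prime pcR.
have [q eq] : exists q, p = q.+1 by exists p.-1; rewrite prednK // prime_gt0.
rewrite iter_leibniz eq big_ord_recl big_ord_recr /= -eq.
rewrite big1 ?add0r => [|i _].
by rewrite bin0 /bump /= ?add1n -?eq subnn binn.
rewrite -mulr_natl; have /dvdnP [a ->] : (p %| 'C(p, bump 0 i))%N.
  by apply: prime_dvd_bin => //; rewrite /bump /= add1n /= eq ltnS.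
by rewrite natrM (pcharf0 pcR) mulr0 mul0r.
Qed.

End LeibnizPower.

(* [D, E] = 1, as for d/de and multiplication by e. *)
Section Weyl.
Variables (K : fieldType) (V : lmodType K) (D E : {linear V -> V}) (Q : V -> Prop).
Hypotheses (QD : forall w, Q w -> Q (D w)) (QE : forall w, Q w -> Q (E w)).
Hypothesis DE : forall w, Q w -> D (E w) = w + E (D w).

Lemma iterQD s w : Q w -> Q (iter s D w).
Proof. by move=> Qw; elim: s => //= s; exact: QD. Qed.

Lemma iterQE s w : Q w -> Q (iter s E w).
Proof. by move=> Qw; elim: s => //= s; exact: QE. Qed.

Lemma iter_scale (F : {linear V -> V}) s a w : iter s F (a *: w) = a *: iter s F w.
Proof. by elim: s => //= s ->; exact: linearZ. Qed.

Lemma weyl_iter s w : Q w ->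
  D (iter s.+1 E w) = s.+1%:R *: iter s E w + iter s.+1 E (D w).
Proof.
move=> Qw; elim: s => [|s IHs]; first by rewrite /= DE // scale1r.
rewrite [iter s.+2 E w]iterS DE; last exact: iterQE.
rewrite IHs linearD linearZ /= addrA; congr (_ + _).
by rewrite -[in RHS]natr1 addrC scalerDl scale1r.
Qed.

Lemma weyl_fact s w : Q w -> D w = 0 -> iter s D (iter s E w) = s`!%:R *: w.
Proof.
move=> Qw Dw; elim: s => [|s IHs]; first by rewrite scale1r.
have E0 r : iter r E 0 = 0 by elim: r => //= r ->; exact: linear0.
by rewrite iterSr weyl_iter // Dw E0 addr0 iter_scale IHs scalerA -natrM factS.
Qed.

(** Repeated integration by parts. The image under [D] of each summand is a difference of
    consecutive terms [a i], and the sum telescopes to [a 0 = w] because [a s] vanishes. Only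
    factorials up to [s] are inverted. *)
Lemma weyl_primitive s w : Q w -> (s`!%:R != 0 :> K) -> iter s D w = 0 ->
  D (\sum_(i < s) ((-1) ^+ i / i.+1`!%:R) *: iter i.+1 E (iter i D w)) = w.
Proof.
move=> Qw s0 Dw.
pose a i := ((-1) ^+ i / i`!%:R) *: iter i E (iter i D w).
have E0 r : iter r E 0 = 0 by elim: r => //= r ->; exact: linear0.
rewrite linear_sum -[LHS]opprK -sumrN.
rewrite (eq_bigr (fun i : 'I_s => a i.+1 - a i)) => [|i _].
  rewrite -(big_mkord xpredT (fun i => a i.+1 - a i)) telescope_sumr //.
  by rewrite /a Dw E0 scaler0 sub0r opprK fact0 divr1 scale1r.
have i0 : i.+1`!%:R != 0 :> K.
  by apply: contraNneq s0 => e; rewrite (fact_split (ltn_ord i)) natrM e mul0r.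
rewrite linearZ /= -/(iter i.+1 E (iter i D w)) weyl_iter; last exact: iterQD.
rewrite scalerDr opprD addrC /a exprS mulN1r mulNr scaleNr; congr (_ - _).
rewrite scalerA; congr (_ *: _).
move: i0; rewrite factS natrM mulf_eq0 negb_or => /andP [n0 f0].
by rewrite invfM mulrA mulrAC divfK.
Qed.

End Weyl.

(** * Euler contraction, exactness, and cohomology of its kernel *)

Section Koszul.
Variables (k : fieldType) (p n : nat).
Hypothesis charkp : p \in [pchar k].
Local Notation K := {fraction {mpoly k[n]}}.
Local Notation W := {mpoly K[n]}.
Local Notation kconst := (@kconst k n).
Local Notation X := (@hcoord k n).
Implicit Types (I J : {set 'I_n}) (m : 'X_{1..n}) (u v w : W) (d : nat).

Lemma pcharK : p \in [pchar K].
Proof. by rewrite (fmorph_pchar kconst). Qed.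

Lemma pcharW : p \in [pchar W].
Proof. exact: (rmorph_pchar (@mpolyC n K) pcharK). Qed.

Let p_pr : prime p := pcharf_prime charkp.

Lemma natK_neq0 s : (0 < s < p)%N -> s%:R != 0 :> K.
Proof.
by move=> /andP [s0 sp]; rewrite -(dvdn_pcharf pcharK) gtnNdvd.
Qed.

Lemma factK_neq0 s : (s < p)%N -> s`!%:R != 0 :> K.
Proof.
elim: s => [|s IHs] sp; first exact: oner_neq0.
rewrite factS natrM; apply: mulf_neq0; last exact/IHs/ltnW.
exact: natK_neq0.
Qed.

(* 'X_i stands for the differential of the i-th homogeneous coordinate, and
   eul is the contraction with the Euler vector field. *)
Definition eul w : W := \sum_i X i *: w^`M(i).

Lemma eul_is_linear : linear eul.
Proof.
move=> a u v; rewrite /eul scaler_sumr -big_split; apply: eq_bigr => i _ /=.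
by rewrite linearP scalerDr !scalerA mulrC.
Qed.

HB.instance Definition _ := GRing.isLinear.Build K W W _ eul eul_is_linear.

Lemma mcoeff_eul w m :
  (eul w)@_m = \sum_i X i * (w@_(m + U_(i)) *+ (m i).+1).
Proof.
by rewrite raddf_sum; apply: eq_bigr => i _ /=; rewrite mcoeffZ mcoeff_deriv.
Qed.

Lemma eulM u v : eul (u * v) = eul u * v + u * eul v.
Proof.
rewrite /eul mulr_suml mulr_sumr -big_split; apply: eq_bigr => i _ /=.
by rewrite mderivM scalerDr scalerAl scalerAr.
Qed.

Lemma eulX i : eul 'X_i = (X i)%:MP.
Proof.
rewrite /eul (bigD1 i) //= big1 => [|l nli].
  rewrite addr0 mderivX mnm1E eqxx scale1r.
  have -> : (U_(i) - U_(i) = 0 :> 'X_{1..n})%MM.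
    by apply/mnmP=> l; rewrite mnmBE subnn mnm0E.
  by rewrite mpolyX0 -mul_mpolyC mulr1.
by rewrite mderivX mnm1E eq_sym (negPf nli) scale0r scaler0.
Qed.

Lemma eulC c : eul c%:MP = 0.
Proof. by apply: big1 => i _; rewrite mderivC scaler0. Qed.

(** The [p]-th iterate is a derivation, so it suffices to test variables; [eul] sends these to
    constants, and a second application already gives 0. *)
Lemma iter_eul_p w : iter p eul w = 0.
Proof.
have z s : iter s eul 0 = 0 by elim: s => //= s ->; exact: linear0.
have leib u v : iter p eul (u * v) = iter p eul u * v + u * iter p eul v.
  exact: (iter_pchar_leibniz eulM _ _ pcharW).
have pE : p = p.-2.+2 by case: p p_pr => [|[]].
rewrite [w]mpolyE; elim: (msupp w) => [|m l IHl]; first by rewrite big_nil z.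
rewrite big_cons iter_add IHl addr0 iter_scale [X in _ *: X](_ : _ = 0) ?scaler0 //.
rewrite mpolyXE_id; apply: (big_ind (fun u => iter p eul u = 0)).
- by rewrite pE iterSr -(mpolyC1 n K) eulC z.
- by move=> u v u0 v0; rewrite leib u0 v0 mul0r mulr0 addr0.
move=> i _; elim: (m i) => [|s IHs]; first by rewrite expr0 pE iterSr -(mpolyC1 n K) eulC z.
rewrite exprS leib IHs mulr0 addr0.
by rewrite pE !iterSr eulX eulC z mul0r.
Qed.

Definition mlt m := [forall i, (m i < p)%N].

(* The normal form modulo the p-th powers of the variables. *)
Definition tau w : W := \sum_(m <- msupp w | mlt m) w@_m *: 'X_[m].

Lemma mcoeff_tau w m : (tau w)@_m = if mlt m then w@_m else 0.
Proof.
rewrite /tau raddf_sum /=.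
under eq_bigr do rewrite mcoeffZ mcoeffX.
have [ms|ms] := boolP (m \in msupp w); last first.
  rewrite (memN_msupp_eq0 ms) if_same big_seq_cond big1 // => m' /andP [m's _].
  by case: eqP => [e|]; rewrite ?mulr0 // -e m's in ms *.
rewrite big_mkcond (bigD1_seq m) ?msupp_uniq //= eqxx mulr1 big1 ?addr0 // => m' nm.
by rewrite (negPf nm) mulr0 if_same.
Qed.

Lemma tau_is_linear : linear tau.
Proof.
move=> a u v; apply/mpolyP=> m; rewrite !(mcoeffD, mcoeffZ, mcoeff_tau).
by case: ifP; rewrite ?mulr0 ?addr0.
Qed.

HB.instance Definition _ := GRing.isLinear.Build K W W _ tau tau_is_linear.

Lemma mltDU m i : mlt (m + U_(i)) -> mlt m.
Proof.
move=> /forallP h; apply/forallP=> l; apply: leq_ltn_trans (h l).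
by rewrite mnmDE leq_addr.
Qed.

(** A dropped monomial could only return through differentiating an exponent equal to [p], and that
    produces the factor [p = 0]. *)
Lemma eul_tau w : eul (tau w) = tau (eul w).
Proof.
apply/mpolyP=> m; rewrite mcoeff_tau !mcoeff_eul; case: ifP => hm; last first.
  apply: big1 => i _; rewrite mcoeff_tau ifF ?mul0rn ?mulr0 //.
  by apply/negP=> /mltDU; rewrite hm.
apply: eq_bigr => i _; rewrite mcoeff_tau; case: ifP => // /negbT.
move=> /forallPn [l]; rewrite -leqNgt mnmDE mnm1E => hl.
move: hm => /forallP h; move: hl.
case: eqP => [<-|_]; last by rewrite addn0 leqNgt h.
rewrite addn1 => hl; have -> : (m i).+1 = p by apply/eqP; rewrite eqn_leq hl h.
by rewrite -mulr_natl -(mulr_natl (w@__)) (pcharf0 pcharK) !mul0r.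
Qed.

Definition truncated w := tau w = w.

Lemma truncatedP w : truncated w <-> (forall m, w@_m != 0 -> mlt m).
Proof.
split=> [<- m|h]; first by rewrite mcoeff_tau; case: ifP => //; rewrite eqxx.
apply/mpolyP=> m; rewrite mcoeff_tau; case: ifP => // /negbT hm.
by apply/esym/eqP; apply: contraNT hm; exact: h.
Qed.

Lemma truncated_eul w : truncated w -> truncated (eul w).
Proof. by move=> h; rewrite /truncated -eul_tau h. Qed.

Lemma tauK w : truncated (tau w).
Proof. by apply/mpolyP=> m; rewrite !mcoeff_tau; case: (mlt m). Qed.

(* Truncated multiplication by the local section e with eul e = 1. *)
Definition mule i w : W := tau ((X i)^-1 *: ('X_i * w)).

Lemma mule_is_linear i : linear (mule i).
Proof.
move=> a u v; rewrite /mule mulrDr scalerDr -scalerAr scalerA mulrC -scalerA.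
exact: linearP.
Qed.

HB.instance Definition _ i := GRing.isLinear.Build K W W _ (mule i) (mule_is_linear i).

Lemma eul_mule i w : truncated w -> eul (mule i w) = w + mule i (eul w).
Proof.
move=> tw; rewrite /mule eul_tau linearZ /= eulM eulX scalerDr linearD /=.
by rewrite mul_mpolyC scalerA mulVf ?hcoord_neq0 // scale1r tw.
Qed.

(* The sections over D_+(xprod I) of T_p Sym^d E. *)
Definition kform d I w := forall m, loc I (- d%:Z) w@_m /\
  (w@_m != 0 -> mlt m && (mdeg m == d)).

Lemma kform_truncated d I w : kform d I w -> truncated w.
Proof. by move=> Cw; apply/truncatedP=> m /(Cw m).2 /andP []. Qed.

Lemma kform_sub d : submodules kconst (kform d).
Proof.
move=> I; split=> [m|]; first by rewrite mcoeff0 eqxx; split=> //; exact: loc0.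
split=> [u v Cu Cv m|a v Cv m].
  rewrite mcoeffD; split; first by apply: locD; [exact: (Cu m).1|exact: (Cv m).1].
  have [u0|/(Cu m).2 //] := eqVneq u@_m 0; rewrite u0 add0r; exact: (Cv m).2.
rewrite mcoeffZ; split; first exact/locZ/(Cv m).1.
by rewrite mulf_eq0 negb_or => /andP [_]; exact: (Cv m).2.
Qed.

Lemma kform_mono d : monotone (kform d).
Proof.
by move=> I J u sIJ Cu m; split; [exact/(loc_mono sIJ)/(Cu m).1|exact: (Cu m).2].
Qed.

Lemma eul_kform d I w : kform d.+1 I w -> kform d I (eul w).
Proof.
move=> Cw m; rewrite mcoeff_eul; split.
  apply: loc_sum => i _; rewrite mulrnAr -mulr_natl -(rmorph_nat kconst); apply: locZ.
  have -> : - d%:Z = 1 + - d.+1%:Z by rewrite intS opprD addrA subrr add0r.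
  by apply: locM; [exact: loc_hcoord|exact: (Cw _).1].
move=> nz; have [i wi] : exists i, w@_(m + U_(i)) != 0.
  apply/existsP; apply: contraNT nz; rewrite negb_exists => /forallP h.
  apply/eqP/big1 => i _; have := h i; rewrite negbK => /eqP ->.
  by rewrite mul0rn mulr0.
have /andP [/mltDU -> /=] := (Cw _).2 wi.
by rewrite mdegD mdeg1 addn1 eqSS.
Qed.

Lemma eul_kform0 I w : kform 0 I w -> eul w = 0.
Proof.
move=> Cw; apply/mpolyP=> m; rewrite mcoeff_eul mcoeff0; apply: big1 => i _.
have [->|/(Cw _).2 /andP [_]] := eqVneq w@_(m + U_(i)) 0; first by rewrite mul0rn mulr0.
by rewrite mdegD mdeg1 addn1.
Qed.

Lemma mule_kform d I i w : i \in I -> kform d I w -> kform d.+1 I (mule i w).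
Proof.
move=> iI Cw m; rewrite /mule mcoeff_tau mcoeffZ.
have [->|nz] := eqVneq ('X_i * w)@_m 0.
  by rewrite mulr0 if_same eqxx; split=> //; exact: loc0.
have [m' em] : exists m', m = (U_(i) + m')%MM.
  move: nz; rewrite mulrC -mcoeff_msupp (perm_mem (msuppMX _ _)).
  by move=> /mapP [m' _ ->]; exists m'.
move: nz; rewrite em mulrC mcoeffMX => nz; case: ifP => hm; last first.
  by rewrite eqxx; split=> //; exact: loc0.
split.
  have -> : - d.+1%:Z = -1 + - d%:Z by rewrite intS opprD.
  by apply: locM; [exact: loc_Vhcoord|exact: (Cw _).1].
by move=> _; have /andP [_ /eqP <-] := (Cw _).2 nz; rewrite mdegD mdeg1 add1n /=.
Qed.

Lemma iter_eul_kform d s I w : kform (d + s) I w -> kform d I (iter s eul w).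
Proof.
elim: s w => [|s IHs] w; first by rewrite addn0.
by rewrite iterSr addnS => Cw; apply: IHs; exact: eul_kform.
Qed.

Lemma iter_eul_kform0 d s I w : (d < s)%N -> kform d I w -> iter s eul w = 0.
Proof.
have z r : iter r eul 0 = 0 by elim: r => //= r ->; exact: linear0.
elim: s d w => // s IHs [|d] w ds Cw; first by rewrite iterSr (eul_kform0 Cw) z.
by rewrite iterSr; apply: IHs (eul_kform Cw).
Qed.

Lemma iter_mule_kform d s I i w : i \in I -> kform d I w ->
  kform (d + s) I (iter s (mule i) w).
Proof.
move=> iI Cw; elim: s => [|s IHs]; first by rewrite addn0.
by rewrite addnS iterS; exact: mule_kform.
Qed.

Lemma iter_mule_eul_kform d s I i w : i \in I -> kform d I w ->
  kform d I (iter s (mule i) (iter s eul w)).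
Proof.
move=> iI; have z r : iter r (mule i) 0 = 0 by elim: r => //= r ->; exact: linear0.
have [sd|ds] := leqP s d.
  by rewrite -{1 2}(subnK sd) => Cw; apply/iter_mule_kform/iter_eul_kform/Cw.
by move=> Cw; rewrite (iter_eul_kform0 ds Cw) z; apply: (submod0 (kform_sub d)).
Qed.

Lemma kform_scale d I c w : loc I 0 c -> kform d I w -> kform d I (c *: w).
Proof.
move=> lc Cw m; rewrite mcoeffZ; split; first by rewrite -[- _]add0r; apply/locM/(Cw m).1.
by rewrite mulf_eq0 negb_or => /andP [_]; exact: (Cw m).2.
Qed.

Definition ker_eul d I w := kform d I w /\ eul w = 0.

Definition eulp w : W := iter p.-1 eul w.

Lemma eulp_is_linear : linear eulp.
Proof.
move=> a u v; rewrite /eulp iter_add iter_scale //.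
Qed.

HB.instance Definition _ := GRing.isLinear.Build K W W _ eulp eulp_is_linear.

Definition ker_eulp d I w := kform d I w /\ eulp w = 0.

Lemma kform_ker_sub (D : {linear W -> W}) d :
  submodules kconst (fun I w => kform d I w /\ D w = 0).
Proof.
move=> I; split; first by split; [exact: submod0 (kform_sub d) I|exact: linear0].
split=> [u v [Cu Du] [Cv Dv]|a v [Cv Dv]]; split.
- exact: (submodD (kform_sub d)).
- by rewrite linearD Du Dv addr0.
- exact: (submodZ (kform_sub d)).
- by rewrite linearZ /= Dv scaler0.
Qed.

Lemma ker_eul_sub d : submodules kconst (ker_eul d). Proof. exact: kform_ker_sub. Qed.
Lemma ker_eulp_sub d : submodules kconst (ker_eulp d). Proof. exact: kform_ker_sub. Qed.

Lemma eulp_eul w : eulp (eul w) = 0.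
Proof. by rewrite /eulp -iterSr prednK ?prime_gt0 // iter_eul_p. Qed.

Lemma eul_eulp w : eul (eulp w) = 0.
Proof. by rewrite /eulp -iterS prednK ?prime_gt0 // iter_eul_p. Qed.

(** Integration by parts with [s = p - 1], the largest number for which [s!] is invertible. It takes
    place on one chart, with a variable [i] from [I]. *)
Lemma eul_surj d I v : I != set0 -> ker_eulp d I v ->
  exists2 u, kform d.+1 I u & eul u = v.
Proof.
move=> /set0Pn [i iI] [Cv Dv].
eexists; last first.
  apply: (weyl_primitive (E := mule i) (Q := truncated)) Dv.
  - exact: truncated_eul.
  - by move=> w _; exact: tauK.
  - exact: eul_mule.
  - exact: kform_truncated Cv.
  - by apply: factK_neq0; rewrite prednK // prime_gt0.
apply: (submod_sum (kform_sub d.+1)) => s _.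
apply: kform_scale; last exact: (mule_kform iI (iter_mule_eul_kform s iI Cv)).
rewrite -signr_odd -(rmorph_sign kconst) -(rmorph_nat kconst) -fmorphV -rmorphM.
exact: loc_kconst.
Qed.

(** If [v] is killed by [eul], then [p - 1] contractions of e^(p-1) v give (p-1)! v. *)
Lemma eulp_surj d I v : I != set0 -> ker_eul d I v ->
  exists2 u, kform (d + p.-1) I u & eulp u = v.
Proof.
move=> /set0Pn [i iI] [Cv Dv].
have f0 : p.-1`!%:R != 0 :> K by apply: factK_neq0; rewrite prednK // prime_gt0.
exists (p.-1`!%:R^-1 *: iter p.-1 (mule i) v).
  by rewrite -(rmorph_nat kconst) -fmorphV; apply/(submodZ (kform_sub _))/iter_mule_kform.
rewrite linearZ /= /eulp (weyl_fact (Q := truncated)) ?scalerA ?mulVf ?scale1r //.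
- by move=> w _; exact: tauK.
- exact: eul_mule.
- exact: kform_truncated Cv.
Qed.

(** The coefficients are independent sections of O(-d), treated one at a time. For [j = 0] the
    primitive [t] sits on the empty set, so it is not a Cech cochain: this is where the global
    constants in degree 0 survive. *)
Lemma kform_cocycle d j z : (d < n)%N -> cocyc (kform d) j z ->
  exists t, [/\ forall I, kform d I (t I), forall I, #|I| != j -> t I = 0 &
    forall J, z J = delta t J].
Proof.
move=> dn [Cz dz].
have H m : exists t : {set 'I_n} -> K^o,
    [/\ forall I, loc I (- d%:Z) (t I), forall I, #|I| != j -> t I = 0 &
        forall J, (z J)@_m = delta t J].
  apply: (@loc_cocycle k n d j (fun I => (z I)@_m)) => //.
  split=> [I|J]; last by rewrite -mcoeff_delta dz mcoeff0.
  by split=> [|nI]; [exact: ((Cz I).1 m).1|rewrite (Cz I).2 // mcoeff0].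
have {H} [T HT] := all_sig (fun m => cid (H m)).
pose ok m := mlt m && (mdeg m == d).
pose t I : W := \sum_(m : 'X_{1..n < d.+1}) (if ok m then T m I else 0) *: 'X_[m].
have tE I m : (t I)@_m = if ok m then T m I else 0.
  rewrite (mcoeff_bsum _ (fun m => if ok m then T m I else 0)) /ok; case: ltnP => // dm.
  by rewrite [mdeg m == d]gtn_eqF // andbF.
exists t; split=> [I m|I nI|J].
- rewrite tE -/(ok m); case: ifP => _; last by rewrite eqxx; split=> //; exact: loc0.
  by split=> //; have [h _ _] := HT m; exact: h.
- apply/mpolyP=> m; rewrite tE mcoeff0; case: ifP => // _.
  by have [_ h _] := HT m; rewrite h.
apply/mpolyP=> m; rewrite mcoeff_delta.
rewrite (_ : (fun I => _) = (fun I => if ok m then T m I else 0)); last exact/funext.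
case okm : (ok m); first by have [_ _ ->] := HT m.
rewrite delta0 //; apply/eqP; apply: contraFT okm; exact: ((Cz J).1 m).2.
Qed.

Lemma kform_set0 d w : kform d set0 w -> w = 0 \/ d = 0 /\ exists c, w = (kconst c)%:MP.
Proof.
move=> Cw; have d0 : (- d%:Z <= 0)%R by rewrite Num.Theory.oppr_le0.
have H m : w@_m = 0 \/ d = 0 /\ exists c, w@_m = kconst c.
  have [->|[/eqP]] := loc_set0 d0 (Cw m).1; first by left.
  by rewrite oppr_eq0 => /eqP [->]; right.
have [->|nz] := eqVneq w 0; first by left.
have lm : w@_(mlead w) != 0 by rewrite mleadc_eq0.
have [/eqP|[ed [c ec]]] := H (mlead w); first by rewrite (negPf lm).
right; split=> //; exists c; apply/mpolyP=> m; rewrite mcoeffC.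
have /andP [_] := (Cw _).2 lm; rewrite ed mdeg_eq0 => /eqP e0.
case: eqP => [->|nm]; first by rewrite mulr1 -ec e0.
rewrite mulr0; apply/eqP; apply: contraPT nm => /(Cw _).2 /andP [_].
by rewrite ed mdeg_eq0 => /eqP ->.
Qed.

Lemma kform_acyclic d j : (d < n)%N -> ((0 < d) || (0 < j))%N ->
  cohdim kconst (kform d) j 0.
Proof.
move=> dn dj; apply: cohdim0P => z /(kform_cocycle dn) [t [Ct tN zt]].
case: j dj tN => [|j] /= dj tN; last by exists t => // I; split=> //; exact: tN.
have t0 I : t I = 0.
  have [->|I0] := eqVneq I set0; last by rewrite tN // cards_eq0.
  by have [//|[d0]] := kform_set0 (Ct set0); move: dj; rewrite d0.
by move=> J; rewrite zt delta0.
Qed.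

Lemma kform0_H0 : (0 < n)%N -> cohdim kconst (kform 0) 0 1.
Proof.
(* A global constant is recorded on the empty set; [delta (e c)] is then the cochain with value [c]
   on every singleton. *)
move=> n0; pose e c I : W := if I == set0 then (kconst c)%:MP else 0.
have eN c I : #|I| != 0 -> e c I = 0 by rewrite cards_eq0 /e => /negPf ->.
have Ce c : coch (kform 0) 0 (delta (e c)).
  have CE I : kform 0 I (e c I).
    rewrite /e; case: ifP => _; last exact: (submod0 (kform_sub 0)).
    move=> m; rewrite mcoeffC; case: eqP => [->|_].
      rewrite mulr1 oppr0; split; first exact: loc_kconst.
      rewrite mdeg0 eqxx andbT => _; apply/forallP=> i; rewrite mnm0E; exact: prime_gt0.
    by rewrite mulr0 eqxx; split=> //; exact: loc0.
  move=> I; split.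
    apply: (submod_sum (kform_sub 0)) => i iI; rewrite -signr_odd -(rmorph_sign kconst).
    exact/(submodZ (kform_sub 0))/(kform_mono (subD1set I i))/CE.
  move=> nI; apply: big1 => i iI; rewrite eN ?scaler0 //.
  by move: nI; rewrite (cardsD1 i) iI.
have eE a J : delta (e a) J = kconst a *: delta (e 1) J.
  rewrite scaler_sumr; apply: eq_bigr => i _.
  rewrite scalerA mulrC -scalerA; congr (_ *: _); rewrite /e; case: ifP => _.
    by rewrite -mul_mpolyC -mpolyCM -rmorphM mulr1.
  by rewrite scaler0.
exists (fun _ => delta (e 1)) => [_|z /(kform_cocycle n0) [t [Ct tN zt]]].
  by split=> [|J]; [exact: Ce|exact: delta_delta].
have [c ec] : exists c, t = e c.
  have [t0|[_ [c ec]]] := kform_set0 (Ct set0).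
    exists 0; apply/funext => I; rewrite /e (rmorph0 kconst) mpolyC0 if_same.
    by have [->//|I0] := eqVneq I set0; rewrite tN ?cards_eq0.
  exists c; apply/funext => I; rewrite /e; case: eqP => [->//|/eqP I0].
  by rewrite tN ?cards_eq0.
exists [ffun=> c]; split=> [J|a /=].
  by rewrite zt ec /comb big_ord1 ffunE eE subrr.
pose i0 := Ordinal n0; move=> /(_ [set i0]); rewrite zt ec /comb big_ord1 -eE => /eqP.
have E b : delta (e b) [set i0] = (kconst b)%:MP.
  rewrite /delta big_set1 /e setDv eqxx /rank_in (_ : [set l in _ | _] = set0).
    by rewrite cards0 expr0 scale1r.
  by apply/setP=> l; rewrite !inE; case: eqP => // ->; rewrite ltnn.
rewrite !E subr_eq0 mpolyC_eq (inj_eq (fmorph_inj kconst)) => /eqP ->.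
by apply/ffunP=> i; rewrite ffunE; congr (a _); apply/val_inj; case: i => -[].
Qed.

(** The Boolean is read as the dimension 0 or 1. Each step of the strong induction passes through
    the kernel of [eulp], using two short exact sequences whose middle terms are acyclic in the
    relevant degrees. *)
Lemma cohdim_ker_eul d j : (d < n)%N ->
  cohdim kconst (ker_eul d) j ((d %% p <= 1)%N && (j == p_index p d)).
Proof.
have p1 := prime_gt1 p_pr.
have p0 : (p.-1.+1 = p)%N by rewrite prednK // prime_gt0.
elim/ltn_ind: d j => -[_ j n0|d IHd j dn].
  rewrite mod0n /p_index div0n mod0n muln0 /=.
  apply: (@cohdim_eq _ _ _ _ _ (kform 0)) (kform_sub 0) (ker_eul_sub 0) _ _.
    by move=> I u _; split=> [Cu|[]//]; split=> //; exact: eul_kform0 Cu.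
  by case: j => [|j]; [exact: kform0_H0|apply: kform_acyclic].
have kerM I u : I != set0 -> ker_eul d.+1 I u <-> kform d.+1 I u /\ eul u = 0 by [].
have imM I u : kform d.+1 I u -> ker_eulp d I (eul u).
  by move=> Cu; split; [exact: eul_kform|exact: eulp_eul].
have surjM I v := @eul_surj d I v.
have pi_gt0 : (0 < p_index p d.+1)%N.
  rewrite lt0n /p_index addn_eq0 muln_eq0 /=; apply/negP=> /andP [/eqP a /eqP b].
  by have := divn_eq d.+1 p; rewrite a b.
case: j => [|j].
  rewrite eq_sym gtn_eqF // andbF.
  apply: (cohdim_shift0 (ker_eul_sub _) (kform_sub _) kerM).
  exact: kform_acyclic.
apply: (cohdim_shift (ker_eul_sub _) (kform_sub _) (kform_mono (d:=d.+1)) kerM imM surjM);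
  try exact: kform_acyclic.
(* Below [p] the map [eulp] vanishes on degree [d], so its kernel consists of all forms. These
   contribute only for [d = 0], which accounts for the index of 1. *)
have [dp|pd] := ltnP d.+1 p.
  apply: (@cohdim_eq _ _ _ _ _ (kform d)) (kform_sub d) (ker_eulp_sub d) _ _.
    move=> I u _; split=> [Cu|[]//]; split=> //.
    by apply: iter_eul_kform0 Cu; rewrite -ltnS p0.
  rewrite /p_index modn_small // divn_small // muln0 add0n eqSS.
  case: d dn {IHd kerM imM surjM pi_gt0 dp} => [|d] dn; last first.
    by apply: kform_acyclic => //; exact: ltnW dn.
  by case: j => [|j]; [exact/kform0_H0/ltnW|apply: kform_acyclic => //; exact: ltnW].
(* The second sequence has the forms of degree [q + (p - 1)] in the middle and [ker_eul q] on the
   right; together the two connecting maps add 2 to the index. *)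
pose q := (d.+1 - p)%N; have dq : d = (q + p.-1)%N.
  by apply: succn_inj; rewrite -addnS p0 subnK.
have d_gt0 : (0 < d)%N by rewrite dq ltn_addl // -ltnS p0.
have kerN I u : I != set0 -> ker_eulp d I u <-> kform d I u /\ eulp u = 0 by [].
have imN I u : kform d I u -> ker_eul q I (eulp u).
  by rewrite {1}dq => Cu; split; [exact: iter_eul_kform|exact: eul_eulp].
have surjN I v : I != set0 -> ker_eul q I v -> exists2 u, kform d I u & eulp u = v.
  by rewrite [X in kform X]dq; exact: eulp_surj.
have eqd : d.+1 = (q + p)%N by rewrite dq -addnS p0.
have -> : p_index p d.+1 = (p_index p q).+2.
  by rewrite /p_index eqd modnDr divnDr // divnn (ltnW p1) addn1 mulnS.
rewrite eqd modnDr; case: j => [|j].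
  rewrite andbF; apply: (cohdim_shift0 (ker_eulp_sub _) (kform_sub _) kerN).
  by apply: kform_acyclic; rewrite ?d_gt0 // ltnW.
rewrite !eqSS.
apply: (cohdim_shift (ker_eulp_sub _) (kform_sub _) (kform_mono (d:=d)) kerN imN surjN);
  try by apply: kform_acyclic; rewrite ?d_gt0 // ltnW.
apply: IHd; first by rewrite eqd -ltn_subLR // subnn ltnW.
by rewrite (leq_ltn_trans _ dn) // eqd leq_addr.
Qed.

End Koszul.

(** * Derivations of fractions and maps out of quotients *)

Lemma quotient_ruleM (F : fieldType) (a b c e a' b' c' e' : F) :
  b != 0 -> e != 0 ->
  ((a' * c + a * c') * (b * e) - a * c * (b' * e + b * e')) / (b * e) ^+ 2 =
  a / b * ((c' * e - c * e') / e ^+ 2) + c / e * ((a' * b - a * b') / b ^+ 2).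
Proof. by move=> b0 e0; field; rewrite b0 e0. Qed.

Section FracDerivation.
Variables (R : idomainType) (D : {additive R -> R}).
Hypothesis DM : forall u v, D (u * v) = D u * v + u * D v.
Local Notation K := {fraction R}.

Lemma frac_repr (x : K) : x = (\n_(repr x))%:F / (\d_(repr x))%:F.
Proof.
have d0 : (\d_(repr x))%:F != 0 by rewrite tofrac_eq0 denom_ratioP.
apply: (mulIf d0); rewrite divfK // -{1}[x]reprK; unlock FracField.tofrac.
rewrite -[LHS]FracField.pi_mul; apply/eqmodP.
rewrite /= FracField.equivfE /FracField.mulf !numden_Ratio ?mulr1 ?oner_neq0 ?denom_ratioP //.
by rewrite mulrC.
Qed.

Lemma frac_ex (x : K) : exists a b, b != 0 /\ x = a%:F / b%:F.
Proof. by exists \n_(repr x), \d_(repr x); rewrite -frac_repr denom_ratioP. Qed.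

Definition fderiv (x : K) : K := let a := \n_(repr x) in let b := \d_(repr x) in
  ((D a)%:F * b%:F - a%:F * (D b)%:F) / b%:F ^+ 2.

(** The quotient rule does not depend on the fraction chosen: the cross-multiplied difference is a
    combination of the equality of the two fractions and of its derivative. *)
Lemma fderivE (a b : R) : b != 0 ->
  fderiv (a%:F / b%:F) = ((D a)%:F * b%:F - a%:F * (D b)%:F) / b%:F ^+ 2.
Proof.
move=> b0; rewrite /fderiv; set r := repr _.
have d0 : \d_r != 0 by exact: denom_ratioP.
have bF : b%:F != 0 by rewrite tofrac_eq0.
have dF : (\d_r)%:F != 0 by rewrite tofrac_eq0.
have : a * \d_r = \n_r * b.
  have /eqP := frac_repr (a%:F / b%:F); rewrite -/r eqr_div // -!tofracM tofrac_eq.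
  by move/eqP.
move: {r d0} (\n_r) (\d_r) dF => c e eF ec.
have := congr1 D ec; rewrite !DM => /(congr1 (@FracField.tofrac R)).
move/(congr1 (@FracField.tofrac R)): ec; rewrite !tofracD !tofracM.
move: bF eF; move: (a%:F) (b%:F) (c%:F) (e%:F) (D a)%:F (D b)%:F (D c)%:F (D e)%:F.
move=> A B C' E A' B' C1 E1 B0 E0 ec dec.
apply/eqP; rewrite eqr_div ?expf_neq0 // -subr_eq0; apply/eqP.
have -> : (C1 * E - C' * E1) * B ^+ 2 - (A' * B - A * B') * E ^+ 2 =
    E * B * (C1 * B + C' * B' - (A' * E + A * E1)) +
    (E1 * B + B' * E) * (A * E - C' * B) by ring.
by rewrite ec dec !subrr !mulr0 addr0.
Qed.

Lemma fderivD x y : fderiv (x + y) = fderiv x + fderiv y.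
Proof.
have [a [b [b0 ->]]] := frac_ex x; have [c [e [e0 ->]]] := frac_ex y.
have bF : b%:F != 0 by rewrite tofrac_eq0.
have eF : e%:F != 0 by rewrite tofrac_eq0.
rewrite addf_div // -!tofracM -tofracD !fderivE ?mulf_neq0 //.
rewrite raddfD !DM !(tofracD, tofracM) addf_div ?expf_neq0 // exprMn.
congr (_ / _).
move: (a%:F) (b%:F) (c%:F) (e%:F) (D a)%:F (D b)%:F (D c)%:F (D e)%:F.
move=> A B C E A' B' C' E'; ring.
Qed.

Lemma fderivM x y : fderiv (x * y) = x * fderiv y + y * fderiv x.
Proof.
have [a [b [b0 ->]]] := frac_ex x; have [c [e [e0 ->]]] := frac_ex y.
have bF : b%:F != 0 by rewrite tofrac_eq0.
have eF : e%:F != 0 by rewrite tofrac_eq0.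
rewrite mulf_div -!tofracM !fderivE ?mulf_neq0 // !DM !(tofracD, tofracM).
move: bF eF; move: (a%:F) (b%:F) (c%:F) (e%:F) (D a)%:F (D b)%:F (D c)%:F (D e)%:F.
by move=> A B C E A' B' C' E' B0 E0; exact: quotient_ruleM.
Qed.

Lemma fderiv_tofrac a : fderiv a%:F = (D a)%:F.
Proof.
have D1 : D 1 = 0.
  by have := DM 1 1; rewrite !mulr1 mul1r -[X in X = _]addr0 => /addrI.
by rewrite -[a%:F]divr1 -tofrac1 fderivE ?oner_neq0 // D1 tofrac0 tofrac1 mulr0 subr0
  expr1n mulr1 divr1.
Qed.

End FracDerivation.

(** * Semilinear maps out of free modules and their quotients *)

Section FreegLift.
Variables (A K : comNzRingType) (rho : {rmorphism A -> K}) (V : lmodType K).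
Variables (T : choiceType) (F : T -> V).

Definition flift (x : {freeg T / A}) : V :=
  \sum_(s <- dom x) rho (coeff s x) *: F s.

(** Enlarging the index list beyond the support lets sums with different supports be compared. *)
Lemma flift_big (r : seq T) x : uniq r -> {subset dom x <= r} ->
  flift x = \sum_(s <- r) rho (coeff s x) *: F s.
Proof.
move=> ur sr; rewrite /flift (bigID (fun s => s \in dom x) (r := r)) /= [X in _ + X]big1.
  rewrite addr0 -[RHS]big_filter; apply: perm_big; apply: uniq_perm.
  - exact: uniq_dom.
  - exact: filter_uniq.
  - by move=> s; rewrite mem_filter andb_idr //; exact: sr.
by move=> s /coeff_outdom ->; rewrite rmorph0 scale0r.
Qed.

Lemma fliftD x y : flift (x + y) = flift x + flift y.
Proof.
pose r := undup (dom x ++ dom y); have ur : uniq r by exact: undup_uniq.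
rewrite !(flift_big ur); first last.
- by move=> s; rewrite mem_undup; exact: domD_subset.
- by move=> s sx; rewrite mem_undup mem_cat sx.
- by move=> s sy; rewrite mem_undup mem_cat sy orbT.
by rewrite -big_split; apply: eq_bigr => s _ /=; rewrite coeffD rmorphD scalerDl.
Qed.

Lemma fliftZ a x : flift (a *: x) = rho a *: flift x.
Proof.
rewrite (flift_big (uniq_dom x)); last exact: domZ_subset.
by rewrite scaler_sumr; apply: eq_bigr => s _; rewrite coeffZ rmorphM scalerA.
Qed.

Lemma fliftN x : flift (- x) = - flift x.
Proof. by rewrite -[- x]scaleN1r fliftZ rmorphN1 scaleN1r. Qed.

Lemma fliftU c s : flift << c *g s >> = rho c *: F s.
Proof.
rewrite /flift; have [->|c0] := eqVneq c 0.
  by rewrite freegU0 dom0 big_nil rmorph0 scale0r.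
by rewrite domU // big_seq1 coeffU eqxx mulr1.
Qed.

Lemma flift_sum I (r : seq I) (G : I -> {freeg T / A}) :
  flift (\sum_(i <- r) G i) = \sum_(i <- r) flift (G i).
Proof.
elim: r => [|i r IHr]; last by rewrite !big_cons fliftD IHr.
by rewrite !big_nil /flift dom0 big_nil.
Qed.

End FreegLift.

Lemma flift_freeg_map (A B K : comNzRingType) (phi : A -> B)
    (rA : {rmorphism A -> K}) (rB : {rmorphism B -> K}) (V : lmodType K)
    (S T : choiceType) (f : S -> T) (FA : S -> V) (FB : T -> V) x :
  (forall a, rB (phi a) = rA a) -> (forall s, FB (f s) = FA s) ->
  flift rB FB (freeg_map phi f x) = flift rA FA x.
Proof.
move=> hr hF; rewrite /freeg_map flift_sum; apply: eq_bigr => s _.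
by rewrite fliftU hr hF.
Qed.

Section QuotientLift.
Variables (A K : comNzRingType) (rho : {rmorphism A -> K}).
Variables (V : lmodType A) (W : lmodType K) (G : V -> Prop) (F : V -> W).
Hypotheses (FD : forall u v, F (u + v) = F u + F v).
Hypotheses (FZ : forall a v, F (a *: v) = rho a *: F v).
Hypothesis FG : forall g, G g -> F g = 0.

Definition qlift (x : qmod G) : W := F (repr x).

Lemma qliftE v : qlift (qclass G v) = F v.
Proof.
have F0 : F 0 = 0 by rewrite -(scale0r 0) FZ rmorph0 scale0r.
have FN u : F (- u) = - F u by rewrite -scaleN1r FZ rmorphN1 scaleN1r.
have : qclass G (repr (qclass G v)) == qclass G v by rewrite qclassK.
rewrite qclassP => /asboolP s; apply/eqP; rewrite -subr_eq0 -FN -FD; apply/eqP.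
by elim: s => // a g u Gg _ Fu; rewrite FD FZ FG // scaler0 add0r.
Qed.

Lemma qliftD x y : qlift (x + y) = qlift x + qlift y.
Proof. by rewrite -[x]qclassK -[y]qclassK -qclassD !qliftE. Qed.

Lemma qliftZ a x : qlift (a *: x) = rho a *: qlift x.
Proof. by rewrite -[x]qclassK -[a *: _]/(qscale a _) -qclassZ !qliftE. Qed.

End QuotientLift.

(** * The map from truncated symmetric powers of differentials *)

Section KaehlerLift.
Variables (k A K : comNzRingType) (iota : k -> A) (rho : {rmorphism A -> K}).
Variables (W : lmodType K) (D : A -> W).
Hypothesis DD : forall a b, D (a + b) = D a + D b.
Hypothesis DM : forall a b, D (a * b) = rho a *: D b + rho b *: D a.
Hypothesis Dc : forall c, D (iota c) = 0.

Lemma flift_kaehler_rel x : kaehler_rel iota x -> flift rho D x = 0.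
Proof.
case=> [a b|a b|c]; rewrite !(fliftD, fliftN, fliftZ, fliftU) ?rmorph1 ?scale1r.
- by rewrite DD -addrA -opprD subrr.
- by rewrite DM -addrA -opprD subrr.
- exact: Dc.
Qed.

Definition kaehler_lift : kaehler iota -> W := qlift (flift rho D).

Lemma kaehler_liftE x : kaehler_lift (qclass (kaehler_rel iota) x) = flift rho D x.
Proof.
apply: (qliftE (rho := rho)); [exact: fliftD|exact: fliftZ|exact: flift_kaehler_rel].
Qed.

Lemma kaehler_lift_d a : kaehler_lift (qclass (kaehler_rel iota) << a >>) = D a.
Proof. by rewrite kaehler_liftE fliftU rmorph1 scale1r. Qed.

Lemma kaehler_liftD u v : kaehler_lift (u + v) = kaehler_lift u + kaehler_lift v.
Proof.
apply: (qliftD (rho := rho)); [exact: fliftD|exact: fliftZ|exact: flift_kaehler_rel].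
Qed.

Lemma kaehler_liftZ a u : kaehler_lift (a *: u) = rho a *: kaehler_lift u.
Proof.
apply: (qliftZ (rho := rho)); [exact: fliftD|exact: fliftZ|exact: flift_kaehler_rel].
Qed.

End KaehlerLift.

Section SymLift.
Variables (A K : comNzRingType) (rho : {rmorphism A -> K}).
Variables (V : lmodType A) (W : comAlgType K) (phi : V -> W) (d : nat).
Hypothesis phiD : forall u v, phi (u + v) = phi u + phi v.
Hypothesis phiZ : forall a u, phi (a *: u) = rho a *: phi u.

Definition phi_prod (t : {ffun 'I_d -> V}) : W := \prod_j phi (t j).

Lemma phi_prod_upd t i u :
  phi_prod (upd t i u) = phi u * \prod_(j | j != i) phi (t j).
Proof.
rewrite /phi_prod (bigD1 i) //= ffunE eqxx; congr (_ * _); apply: eq_bigr => j nj.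
by rewrite ffunE (negPf nj).
Qed.

Lemma flift_sym_rel x : sym_rel x -> flift rho phi_prod x = 0.
Proof.
case=> [t i u v|t i a u|t s]; rewrite !(fliftD, fliftN, fliftZ, fliftU) ?rmorph1 ?scale1r.
- by rewrite !phi_prod_upd phiD mulrDl -addrA -opprD subrr.
- by rewrite !phi_prod_upd phiZ scalerAl subrr.
- apply/eqP; rewrite subr_eq0; apply/eqP.
  rewrite [RHS](reindex_inj (@perm_inj _ s)) /=; apply: eq_bigr => j _.
  by rewrite ffunE.
Qed.

Definition sym_lift : Defs.Sym V d -> W := qlift (flift rho phi_prod).

Lemma sym_liftE x : sym_lift (qclass (@sym_rel A V d) x) = flift rho phi_prod x.
Proof.
apply: (qliftE (rho := rho)); [exact: fliftD|exact: fliftZ|exact: flift_sym_rel].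
Qed.

Lemma sym_lift_prod t : sym_lift (sym_prod t) = \prod_j phi (t j).
Proof. by rewrite sym_liftE fliftU rmorph1 scale1r. Qed.

Lemma sym_liftD u v : sym_lift (u + v) = sym_lift u + sym_lift v.
Proof.
apply: (qliftD (rho := rho)); [exact: fliftD|exact: fliftZ|exact: flift_sym_rel].
Qed.

Lemma sym_liftZ a u : sym_lift (a *: u) = rho a *: sym_lift u.
Proof.
apply: (qliftZ (rho := rho)); [exact: fliftD|exact: fliftZ|exact: flift_sym_rel].
Qed.

Variables (p : nat) (T : {linear W -> W}).
Hypothesis Tp : forall v w, T (phi v ^+ p * w) = 0.

Lemma sym_lift_frob x : @frob_image A V d p x -> T (sym_lift x) = 0.
Proof.
case=> v t pd tv; rewrite sym_lift_prod (bigID (fun j : 'I_d => (j < p)%N)) /=.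
rewrite (eq_bigr (fun _ => phi v)) => [|j jp]; last by rewrite tv.
rewrite prodr_const (_ : #|_| = p) ?Tp //.
rewrite -sum1_card -[RHS]card_ord -[RHS]sum1_card.
exact/esym/(big_ord_widen _ (fun _ => 1%N) pd).
Qed.

(** [T] will be the truncation [tau]: products with a [p]-th power vanish only after it, so it is
    applied before passing to the quotient. *)
Definition tsym_lift : TSym V d p -> W := qlift (T \o sym_lift).

Let TD u v : (T \o sym_lift) (u + v) = (T \o sym_lift) u + (T \o sym_lift) v.
Proof. by rewrite /= sym_liftD linearD. Qed.

Let TZ a u : (T \o sym_lift) (a *: u) = rho a *: (T \o sym_lift) u.
Proof. by rewrite /= sym_liftZ linearZ. Qed.

Lemma tsym_liftE x : tsym_lift (qclass (@frob_image A V d p) x) = T (sym_lift x).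
Proof. exact: (qliftE (rho := rho) TD TZ sym_lift_frob). Qed.

Lemma tsym_lift_prod t :
  tsym_lift (qclass (@frob_image A V d p) (sym_prod t)) = T (\prod_j phi (t j)).
Proof. by rewrite tsym_liftE sym_lift_prod. Qed.

Lemma tsym_liftD u v : tsym_lift (u + v) = tsym_lift u + tsym_lift v.
Proof. exact: (qliftD (rho := rho) TD TZ sym_lift_frob). Qed.

Lemma tsym_liftZ a u : tsym_lift (a *: u) = rho a *: tsym_lift u.
Proof. exact: (qliftZ (rho := rho) TD TZ sym_lift_frob). Qed.

End SymLift.

Lemma kaehler_lift_map (k A B K : comNzRingType) (iA : k -> A) (iB : k -> B)
    (rA : {rmorphism A -> K}) (rB : {rmorphism B -> K}) (W : lmodType K)
    (DA : A -> W) (DB : B -> W) (f : A -> B)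
    (DD : forall a b, DB (a + b) = DB a + DB b)
    (DM : forall a b, DB (a * b) = rB a *: DB b + rB b *: DB a)
    (Dc : forall c, DB (iB c) = 0) :
  (forall a, rB (f a) = rA a) -> (forall a, DB (f a) = DA a) ->
  forall u : kaehler iA,
  kaehler_lift rB DB (kaehler_map f u : kaehler iB) = kaehler_lift rA DA u.
Proof. by move=> rf Df u; rewrite kaehler_liftE //; exact: flift_freeg_map. Qed.

Lemma tsym_lift_map (A B K : comNzRingType)
    (rA : {rmorphism A -> K}) (rB : {rmorphism B -> K}) (W : comAlgType K)
    (VA : lmodType A) (VB : lmodType B) (phiA : VA -> W) (phiB : VB -> W)
    (phiD : forall u v, phiB (u + v) = phiB u + phiB v)
    (phiZ : forall a u, phiB (a *: u) = rB a *: phiB u)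
    (p d : nat) (T : {linear W -> W})
    (Tp : forall v w, T (phiB v ^+ p * w) = 0) (f : A -> B) (g : VA -> VB) :
  (forall a, rB (f a) = rA a) -> (forall a, phiB (g a) = phiA a) ->
  forall u : TSym VA d p,
  tsym_lift rB phiB T (TSym_map f g u) = tsym_lift rA phiA T u.
Proof.
move=> rf gf u; rewrite tsym_liftE //= sym_liftE //; congr (T _).
apply: flift_freeg_map => // t; apply: eq_bigr => j _.
by rewrite ffunE gf.
Qed.

(** * Differentials of rational functions as linear forms *)

Section CotangentMap.
Variables (k : fieldType) (p n : nat).
Hypothesis charkp : p \in [pchar k].
Local Notation S := {mpoly k[n]}.
Local Notation K := {fraction {mpoly k[n]}}.
Local Notation W := {mpoly K[n]}.
Local Notation kconst := (@kconst k n).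
Local Notation X := (@hcoord k n).
Implicit Types (I J : {set 'I_n}) (f g : K).

(** The total differential, with ['X_i] in the role of dx_i. *)
Definition dK f : W := \sum_i fderiv (mderiv i : {additive S -> S}) f *: 'X_i.

Let DM i (u v : S) : (mderiv i : {additive S -> S}) (u * v) =
  (mderiv i : {additive S -> S}) u * v + u * (mderiv i : {additive S -> S}) v.
Proof. exact: mderivM. Qed.

Lemma dKD f g : dK (f + g) = dK f + dK g.
Proof.
rewrite /dK -big_split; apply: eq_bigr => i _ /=.
by rewrite (fderivD (DM i)) scalerDl.
Qed.

Lemma dKM f g : dK (f * g) = f *: dK g + g *: dK f.
Proof.
rewrite /dK !scaler_sumr -big_split; apply: eq_bigr => i _ /=.
by rewrite (fderivM (DM i)) scalerDl !scalerA.
Qed.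

Lemma dK_const c : dK (kconst c) = 0.
Proof.
apply: big1 => i _; rewrite (fderiv_tofrac (DM i)) /= mderivC tofrac0.
by rewrite scale0r.
Qed.

Lemma dK_X j : dK (X j) = 'X_j.
Proof.
rewrite /dK (bigD1 j) //= big1 => [|i nij].
  rewrite (fderiv_tofrac (DM j)) /= mderivX mnm1E eqxx scale1r addr0.
  have -> : (U_(j) - U_(j) = 0 :> 'X_{1..n})%MM.
    by apply/mnmP=> l; rewrite mnmBE subnn mnm0E.
  by rewrite mpolyX0 tofrac1 scale1r.
rewrite (fderiv_tofrac (DM i)) /= mderivX mnm1E eq_sym (negPf nij).
by rewrite scale0r tofrac0 scale0r.
Qed.

Lemma dK_ratio j i : dK (X j / X i) = (X i)^-1 *: ('X_j - (X j / X i) *: 'X_i).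
Proof.
have := dKM (X j / X i) (X i); rewrite divfK ?hcoord_neq0 // !dK_X => ->.
by rewrite addrC addKr scalerA mulVf ?hcoord_neq0 // scale1r.
Qed.

Lemma dK_coeff0 f : (dK f)@_0%MM = 0.
Proof.
rewrite raddf_sum big1 //= => i _; rewrite mcoeffZ mcoeffX.
by rewrite mnm1_eq0 mulr0.
Qed.

Definition rho I : {rmorphism chart k I -> K} := \val.

Definition dchart I (a : chart k I) : W := dK (rho I a).

Lemma dchartD I (a b : chart k I) : dchart (a + b) = dchart a + dchart b.
Proof. by rewrite /dchart rmorphD dKD. Qed.

Lemma dchartM I (a b : chart k I) :
  dchart (a * b) = rho I a *: dchart b + rho I b *: dchart a.
Proof. by rewrite /dchart rmorphM dKM. Qed.

Lemma dchart_const I (c : k) : dchart (chart_const I c) = 0.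
Proof. exact: dK_const. Qed.

Definition phi I : Omega k I -> W := kaehler_lift (rho I) (@dchart I).

Lemma phi_d I (a : chart k I) :
  phi (qclass (kaehler_rel (chart_const I)) << a >>) = dK (val a).
Proof.
exact: (kaehler_lift_d (@dchartD I) (@dchartM I) (@dchart_const I)).
Qed.

Lemma phiD I (u v : Omega k I) : phi (u + v) = phi u + phi v.
Proof.
exact: (kaehler_liftD (@dchartD I) (@dchartM I) (@dchart_const I)).
Qed.

Lemma phiZ I a (u : Omega k I) : phi (a *: u) = rho I a *: phi u.
Proof.
exact: (kaehler_liftZ (@dchartD I) (@dchartM I) (@dchart_const I)).
Qed.

(** The absence of a constant term is what makes [p]-th powers of these forms vanish under
    truncation. *)
Lemma phi_coeff0 I (u : Omega k I) : (phi u)@_0%MM = 0.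
Proof.
rewrite /phi /kaehler_lift /qlift /flift raddf_sum big1 //= => s _.
by rewrite mcoeffZ dK_coeff0 mulr0.
Qed.

Lemma phi_res I J (sIJ : I \subset J) (u : Omega k I) :
  phi (Omega_res sIJ u) = phi u.
Proof.
apply: (kaehler_lift_map (@dchartD J) (@dchartM J) (@dchart_const J)); by [].
Qed.

Lemma tau_Xp (m : 'X_{1..n}) (u : W) : m != 0%MM -> tau p ('X_[m] ^+ p * u) = 0.
Proof.
move=> m0; apply/mpolyP=> m'; rewrite mcoeff0 mcoeff_tau; case: ifP => // /forallP hm.
apply: memN_msupp_eq0; rewrite mpolyXn mulrC (perm_mem (msuppMX _ _)).
apply/negP=> /mapP [m1 _ e]; move/eqP: m0; apply; apply/mnmP=> i.
have := hm i; rewrite e mnmDE mulmnE mnm0E.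
by case: (m i) => // s; rewrite mulSn ltnNge -addnA leq_addr.
Qed.

(** Frobenius is additive, so [w ^+ p] is a combination of [p]-th powers of nonconstant monomials,
    each of which forces an exponent at least [p]. *)
Lemma tau_pow_p (w u : W) : w@_0%MM = 0 -> tau p (w ^+ p * u) = 0.
Proof.
move=> w0; have pcW := pcharW n charkp.
rewrite [w]mpolyE -(pFrobenius_autE pcW) raddf_sum mulr_suml raddf_sum /=.
rewrite big_seq; apply: big1 => m mw; rewrite pFrobenius_autE exprZn -scalerAl linearZ /=.
rewrite tau_Xp ?scaler0 //; apply: contraTneq mw => ->.
by rewrite mcoeff_msupp w0 eqxx.
Qed.

Variable d : nat.

Lemma tau_phi I (v : Omega k I) (w : W) : tau p (phi v ^+ p * w) = 0.
Proof. exact/tau_pow_p/phi_coeff0. Qed.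

Definition Phi I : TSymOmega k p d I -> W :=
  tsym_lift (W := W) (rho I) (@phi I) (@tau k p n).

Lemma Phi_prod I (t : {ffun 'I_d -> Omega k I}) :
  Phi (qclass (@frob_image _ (Omega k I) d p) (sym_prod t)) = tau p (\prod_j phi (t j)).
Proof. exact: (tsym_lift_prod (W := W) (@phiD I) (@phiZ I) (@tau_phi I)). Qed.

Lemma PhiD I (x y : TSymOmega k p d I) : Phi (x + y) = Phi x + Phi y.
Proof. exact: (tsym_liftD (W := W) (@phiD I) (@phiZ I) (@tau_phi I)). Qed.

Lemma PhiZ I a (x : TSymOmega k p d I) : Phi (a *: x) = rho I a *: Phi x.
Proof. exact: (tsym_liftZ (W := W) (@phiD I) (@phiZ I) (@tau_phi I)). Qed.

Lemma Phi_res I J (sIJ : I \subset J) (x : TSymOmega k p d I) :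
  Phi (TSymOmega_res sIJ x) = Phi x.
Proof.
apply: (tsym_lift_map (W := W) (@phiD J) (@phiZ J) (@tau_phi J)).
  by [].
exact: phi_res.
Qed.

End CotangentMap.

(** * Generators *)

Section FiniteSpan.
Variables (A : comNzRingType) (V : lmodType A) (T : finType) (y : T -> V).

Definition fspan (v : V) := exists c : T -> A, v = \sum_i c i *: y i.

Lemma fspan0 : fspan 0.
Proof. by exists (fun=> 0); rewrite big1 // => i _; rewrite scale0r. Qed.

Lemma fspanD u v : fspan u -> fspan v -> fspan (u + v).
Proof.
move=> [a ->] [b ->]; exists (fun i => a i + b i); rewrite -big_split.
by apply: eq_bigr => i _; rewrite scalerDl.
Qed.

Lemma fspanZ a v : fspan v -> fspan (a *: v).
Proof.
move=> [b ->]; exists (fun i => a * b i); rewrite scaler_sumr.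
by apply: eq_bigr => i _; rewrite scalerA.
Qed.

Lemma fspan_gen i : fspan (y i).
Proof.
exists (fun j => (j == i)%:R); rewrite (bigD1 i) //= eqxx scale1r big1 ?addr0 //.
by move=> j /negPf ->; rewrite scale0r.
Qed.

Lemma fspan_sum I (r : seq I) (F : I -> V) :
  (forall i, fspan (F i)) -> fspan (\sum_(i <- r) F i).
Proof. by move=> h; apply: big_ind => //; [exact: fspan0|exact: fspanD]. Qed.

End FiniteSpan.

Section QuotientGenerators.
Variables (A : comNzRingType) (V : lmodType A) (G : V -> Prop).

Lemma qclass_scale a v : qclass G (a *: v) = a *: qclass G v.
Proof. exact: qclassZ. Qed.

Lemma qclass0 : qclass G 0 = 0.
Proof. by rewrite -(scale0r 0) qclass_scale scale0r. Qed.

Lemma qclass_sum I (r : seq I) (F : I -> V) :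
  qclass G (\sum_(i <- r) F i) = \sum_(i <- r) qclass G (F i).
Proof.
elim: r => [|i r IHr]; first by rewrite !big_nil qclass0.
by rewrite !big_cons qclassD IHr.
Qed.

Lemma qclass_gen g : G g -> qclass G g = 0.
Proof.
move=> Gg; apply/eqP; rewrite -qclass0 qclassP; apply/asboolP.
by rewrite subr0 -[g]scale1r -[1 *: g]addr0; apply/in_spanS/in_span0.
Qed.

Lemma qclassN v : qclass G (- v) = - qclass G v.
Proof. by rewrite -scaleN1r qclass_scale scaleN1r. Qed.

End QuotientGenerators.

Lemma freeg_scaleE (A : comNzRingType) (T : choiceType) (x : {freeg T / A}) :
  x = \sum_(s <- dom x) coeff s x *: << s >>.
Proof.
rewrite -{1}[x]freeg_sumE; apply: eq_bigr => s _; apply/eqP/freeg_eqP => t.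
by rewrite coeffZ !coeffU mul1r.
Qed.

Section KaehlerGenerators.
Variables (k A : comNzRingType) (iota : k -> A).

Definition kd (a : A) : kaehler iota := qclass (kaehler_rel iota) << a >>.

Lemma kdD a b : kd (a + b) = kd a + kd b.
Proof.
apply/eqP; rewrite -subr_eq0 opprD addrA /kd -!qclassN -!qclassD.
by apply/eqP/qclass_gen/kaehlerD.
Qed.

Lemma kdM a b : kd (a * b) = a *: kd b + b *: kd a.
Proof.
apply/eqP; rewrite -subr_eq0 opprD addrA /kd -!qclass_scale -!qclassN -!qclassD.
by apply/eqP/qclass_gen/kaehlerM.
Qed.

Lemma kd_const c : kd (iota c) = 0.
Proof. exact/qclass_gen/kaehlerC. Qed.

Lemma kaehler_fspan (T : finType) (y : T -> kaehler iota) :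
  (forall a, fspan y (kd a)) -> forall u, fspan y u.
Proof.
move=> h u; rewrite -[u]qclassK [repr u]freeg_scaleE qclass_sum.
by apply: fspan_sum => a; rewrite qclass_scale; apply/fspanZ/h.
Qed.

End KaehlerGenerators.

Section TruncatedGenerators.
Variables (A : comNzRingType) (V : lmodType A) (d p : nat).

Definition tcls (t : {ffun 'I_d -> V}) : TSym V d p :=
  qclass (@frob_image A V d p) (sym_prod t).

Lemma tcls_updD t i u v : tcls (upd t i (u + v)) = tcls (upd t i u) + tcls (upd t i v).
Proof.
rewrite /tcls -qclassD; congr qclass; apply/eqP; rewrite -subr_eq0 opprD addrA.
by rewrite /sym_prod -!qclassN -!qclassD; apply/eqP/qclass_gen/symD.
Qed.

Lemma tcls_updZ t i a u : tcls (upd t i (a *: u)) = a *: tcls (upd t i u).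
Proof.
rewrite /tcls -qclass_scale; congr qclass; apply/eqP; rewrite -subr_eq0.
by rewrite /sym_prod -qclass_scale -!qclassN -!qclassD; apply/eqP/qclass_gen/symZ.
Qed.

Lemma tcls_perm (t : {ffun 'I_d -> V}) (s : 'S_d) :
  tcls [ffun j => t (s j)] = tcls t.
Proof.
rewrite /tcls; congr qclass; apply/eqP; rewrite -subr_eq0.
by rewrite /sym_prod -!qclassN -!qclassD; apply/eqP/qclass_gen/symC.
Qed.

Lemma tcls_upd_sum t i (T : finType) (c : T -> A) (y : T -> V) :
  tcls (upd t i (\sum_l c l *: y l)) = \sum_l c l *: tcls (upd t i (y l)).
Proof.
elim: (index_enum T) => [|l r IHr].
  by rewrite !big_nil -(scale0r 0) tcls_updZ scale0r.
by rewrite !big_cons tcls_updD tcls_updZ IHr.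
Qed.

Lemma upd_id (t : {ffun 'I_d -> V}) i : upd t i (t i) = t.
Proof. by apply/ffunP=> j; rewrite ffunE; case: eqP => [->|]. Qed.

Lemma tcls_eq0 (t : {ffun 'I_d -> V}) i : t i = 0 -> tcls t = 0.
Proof. by move=> ti; rewrite -(upd_id t i) ti -(scale0r 0) tcls_updZ scale0r. Qed.

Variables (n : nat) (y : 'I_n -> V).

Definition tmon (f : d.-tuple 'I_n) : TSym V d p := tcls [ffun j => y (tnth f j)].

Lemma tsym_fspan : (forall v, fspan y v) -> forall z, fspan tmon z.
Proof.
move=> yspan z; rewrite -[z]qclassK -[repr z]qclassK.
rewrite [repr (repr z)]freeg_scaleE !qclass_sum; apply: fspan_sum => t.
rewrite !qclass_scale; apply: fspanZ; rewrite -/(sym_prod t) -/(tcls t).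
(* The slots from [m] on already hold generators. For [m = d] this is vacuous, and each step expands
   one more slot by multilinearity. *)
suff H m : forall t : {ffun 'I_d -> V},
    (forall j : 'I_d, (m <= j)%N -> exists l, t j = y l) -> fspan tmon (tcls t).
  by apply: (H d) => j; rewrite leqNgt ltn_ord.
elim: m => [|m IHm] {}t ht.
  have [f hf] := fin_all_exists (fun j => ht j isT).
  rewrite (_ : t = [ffun j => y (tnth [tuple f j | j < d] j)]); first exact: fspan_gen.
  by apply/ffunP=> j; rewrite ffunE tnth_mktuple.
have [md|dm] := ltnP m d; last first.
  by apply: IHm => j mj; have := leq_trans dm mj; rewrite leqNgt ltn_ord.
pose i := Ordinal md; have [c ci] := yspan (t i).
rewrite -(upd_id t i) ci tcls_upd_sum; apply: fspan_sum => l; apply: fspanZ.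
apply: IHm => j mj; rewrite ffunE; case: eqP => [_|/eqP nj]; first by exists l.
by apply: ht; rewrite ltn_neqAle mj andbT eq_sym.
Qed.

Definition mcount (f : seq 'I_n) : 'X_{1..n} := (\sum_(i <- f) U_(i))%MM.

Lemma mcountE f i : mcount f i = count_mem i f.
Proof.
rewrite mnm_sumE -sum1_count [RHS]big_mkcond; apply: eq_bigr => l _.
by rewrite mnm1E /=; case: eqP.
Qed.

Lemma mdeg_mcount f : mdeg (mcount f) = size f.
Proof.
rewrite mdeg_sum -sum1_size; apply: eq_bigr => i _; exact: mdeg1.
Qed.

Lemma tmon_perm (f g : d.-tuple 'I_n) : perm_eq f g -> tmon f = tmon g.
Proof.
move=> /tuple_permP [s fs]; rewrite /tmon -[RHS](tcls_perm _ s); congr tcls.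
have {fs} -> : f = [tuple tnth g (s i) | i < d] by exact: val_inj.
by apply/ffunP=> j; rewrite !ffunE tnth_mktuple.
Qed.

Lemma tmon_mcount (f g : d.-tuple 'I_n) : mcount f = mcount g -> tmon f = tmon g.
Proof.
move=> e; apply: tmon_perm; apply/allP=> i _ /=.
by rewrite -!mcountE e.
Qed.

(** The Frobenius relations want the equal factors in the first [p] slots, so the tuple is reordered
    with all copies of [i] in front. *)
Lemma tmon_ge_p (f : d.-tuple 'I_n) i : (p <= mcount f i)%N -> tmon f = 0.
Proof.
rewrite mcountE -size_filter => pf.
pose s := [seq l <- f | l == i] ++ [seq l <- f | predC (pred1 i) l].
have sf : perm_eq s f by rewrite (perm_filterC (pred1 i)).
have ss : size s == d by rewrite (perm_size sf) size_tuple.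
rewrite -(@tmon_perm (Tuple ss)) //; apply: qclass_gen.
have pd : (p <= d)%N.
  by rewrite (leq_trans pf) // size_filter (leq_trans (count_size _ _)) // size_tuple.
apply: (FrobImage (v := y i)) => // j jp; rewrite ffunE; congr y.
rewrite (tnth_nth i) /= nth_cat (leq_trans jp pf).
have : nth i [seq l <- f | l == i] j \in [seq l <- f | l == i].
  by rewrite mem_nth // (leq_trans jp pf).
by rewrite mem_filter => /andP [/eqP].
Qed.

Lemma tmon_gen0 (f : d.-tuple 'I_n) i : y i = 0 -> mcount f i != 0 -> tmon f = 0.
Proof.
move=> yi; rewrite mcountE -lt0n -has_count => /hasP [l lf /eqP li].
have /tnthP [j ej] := lf; apply: (@tcls_eq0 _ j).
by rewrite ffunE -ej li yi.
Qed.

End TruncatedGenerators.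

Lemma mcount_surj n d (m : 'X_{1..n}) : mdeg m = d ->
  exists f : d.-tuple 'I_n, mcount f = m.
Proof.
suff [s [ss sm]] : exists s : seq 'I_n, size s = mdeg m /\ mcount s = m.
  by move=> dm; have sd : size s == d by [rewrite ss dm]; exists (Tuple sd).
have [e] := ubnP (mdeg m); elim: e m => // e IHe m /ltnSE me.
have [/eqP|m0] := eqVneq (mdeg m) 0.
  by rewrite mdeg_eq0 => /eqP ->; exists [::]; rewrite mdeg0 /mcount big_nil.
have [i mi] : exists i, m i != 0.
  apply/existsP; apply: contraNT m0; rewrite negb_exists => /forallP h.
  by rewrite mdegE big1 // => i _; apply/eqP; have := h i; rewrite negbK.
have em : (m - U_(i) + U_(i))%MM = m by rewrite submK // lep1mP.
have dm : mdeg m = (mdeg (m - U_(i))).+1 by rewrite -{1}em mdegD mdeg1 addn1.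
have [|s [ss sm]] := IHe (m - U_(i))%MM; first by rewrite -dm.
by exists (i :: s); rewrite /= ss -dm /mcount big_cons -/(mcount s) sm addmC em.
Qed.

(** * The local isomorphism *)

Section LocalIso.
Variables (k : fieldType) (p n d : nat).
Hypothesis charkp : p \in [pchar k].
Local Notation S := {mpoly k[n]}.
Local Notation K := {fraction {mpoly k[n]}}.
Local Notation W := {mpoly K[n]}.
Local Notation kconst := (@kconst k n).
Local Notation X := (@hcoord k n).
Local Notation rho := (@rho k n).
Variables (I : {set 'I_n}) (i0 : 'I_n).
Hypothesis i0I : i0 \in I.

Lemma ratio_in_chart i j : i \in I -> X j / X i \in in_chart I.
Proof.
move=> iI; apply/loc_chart; rewrite -[0%R](addrN (1 : int)).
by apply: locM; [exact: loc_hcoord|exact: loc_Vhcoord].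
Qed.

Definition chart_coord j : chart k I := Sub (X j / X i0) (ratio_in_chart j i0I).

Definition dcoord j : Omega k I := kd (chart_const I) (chart_coord j).

Lemma kd1 : kd (@chart_const k n I) 1 = 0.
Proof.
have -> : 1 = chart_const I 1 :> chart k I by apply: val_inj; rewrite /= mpolyC1 tofrac1.
exact: kd_const.
Qed.

(** Stated on values in [K], so that a chart element may be factored there; injectivity of [val]
    leads back to the chart. *)
Let Q (f : K) := exists a : chart k I, rho I a = f /\ fspan dcoord (kd (chart_const I) a).

Let QD f g : Q f -> Q g -> Q (f + g).
Proof.
move=> [a [<- sa]] [b [<- sb]]; exists (a + b); split; first exact: rmorphD.
by rewrite kdD; exact: fspanD.
Qed.

Let QM f g : Q f -> Q g -> Q (f * g).
Proof.
move=> [a [<- sa]] [b [<- sb]]; exists (a * b); split; first exact: rmorphM.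
by rewrite kdM; apply: fspanD; exact: fspanZ.
Qed.

Let Qc c : Q (kconst c).
Proof. by exists (chart_const I c); rewrite kd_const; split=> //; exact: fspan0. Qed.

Let Q1 : Q 1. Proof. by rewrite -(rmorph1 kconst); exact: Qc. Qed.

Let QX f s : Q f -> Q (f ^+ s).
Proof. by move=> Qf; elim: s => [|s IHs]; rewrite ?expr0 ?exprS //; exact: QM. Qed.

Let QY j : Q (X j / X i0).
Proof. by exists (chart_coord j); split=> //; exact: fspan_gen. Qed.

Let QV j : j \in I -> Q (X j / X i0)^-1.
Proof.
move=> jI; rewrite invf_div; exists (Sub (X i0 / X j) (ratio_in_chart i0 jI)).
set b : chart k I := Sub _ _; split=> //.
have bY : b * chart_coord j = 1.
  apply: val_inj; rewrite -[val _]/(rho I _) rmorphM -[RHS]/(rho I 1) rmorph1 /=.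
  by rewrite -invf_div mulVf // mulf_neq0 ?invr_neq0 ?hcoord_neq0.
(* Differentiating [b * y = 1] gives db = - b^2 dy. *)
have := kdM (chart_const I) b (chart_coord j); rewrite bY kd1 => /(congr1 (fun v => b *: v)).
rewrite scaler0 scalerDr [X in _ + X]scalerA bY scale1r => /esym/eqP.
rewrite addrC addr_eq0 => /eqP ->; rewrite scalerA -scaleNr.
exact/fspanZ/(fspan_gen dcoord j).
Qed.

Lemma kd_fspan (a : chart k I) : fspan dcoord (kd (chart_const I) a).
Proof.
suff [b [/val_inj <-]] : Q (val a) by [].
have Qprod (J : pred 'I_n) (F : 'I_n -> K) :
    (forall i, J i -> Q (F i)) -> Q (\prod_(i | J i) F i).
  by move=> h; apply: big_ind.
have /asboolP [s [g [gh ->]]] := valP a.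
rewrite [g]mpolyE raddf_sum mulr_suml big_seq.
apply: (big_ind Q); [by rewrite -(rmorph0 kconst); exact: Qc|exact: QD|move=> m mg /=].
rewrite -mul_mpolyC tofracM -mulrA; apply: QM; first exact: Qc.
(* Numerator and denominator have the same degree, so the powers of [X i0] introduced by passing to
   ratios cancel. *)
have -> : ('X_[m] : S)%:F / (xprod k I)%:F ^+ s =
    \prod_i (X i / X i0) ^+ m i * \prod_(i in I) (X i / X i0)^-1 ^+ s.
  have dm : mdeg m = (#|I| * s)%N by move/dhomogP: gh => /(_ _ mg).
  have -> : \prod_i (X i / X i0) ^+ m i = ('X_[m] : S)%:F * (X i0)^-1 ^+ mdeg m.
    rewrite mpolyXE_id rmorph_prod mdegE -prodrXr -big_split.
    by apply: eq_bigr => i _; rewrite exprMn rmorphXn.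
  rewrite prodrXl prodfV.
  have -> : \prod_(i in I) (X i / X i0) = (xprod k I)%:F * (X i0)^-1 ^+ #|I|.
    by rewrite /xprod rmorph_prod big_split /= prodr_const.
  rewrite [(_ * _)^-1 ^+ s]exprVn exprMn -exprM dm invfM mulrACA mulfV ?mulr1 //.
  by rewrite expf_neq0 // invr_neq0 // hcoord_neq0.
by apply: QM; apply: Qprod => i h; apply: QX; [exact: QY|exact: QV].
Qed.

Lemma Omega_fspan (u : Omega k I) : fspan dcoord u.
Proof. exact/kaehler_fspan/kd_fspan. Qed.

Definition dcoord_form j : W := (X i0)^-1 *: ('X_j - (X j / X i0) *: 'X_i0).

Lemma phi_dcoord j : phi (dcoord j) = dcoord_form j.
Proof. by rewrite phi_d dK_ratio. Qed.

Lemma dcoord_i0 : dcoord i0 = 0.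
Proof.
rewrite /dcoord (_ : chart_coord i0 = 1) ?kd1 //; apply: val_inj => /=.
by rewrite divff ?hcoord_neq0.
Qed.

(** Congruence modulo the variable ['X_i0]. Modulo it the form of [dcoord j] is just ['X_j] divided
    by [X i0]. *)
Definition agree0 (u v : W) := forall m : 'X_{1..n}, m i0 = 0%N -> u@_m = v@_m.

Lemma agree0M u u' v v' : agree0 u u' -> agree0 v v' -> agree0 (u * v) (u' * v').
Proof.
move=> hu hv m m0; rewrite !mcoeffM; apply: eq_bigr => -[a b] /= /eqP em.
have /esym/eqP := congr1 (fun x : 'X_{1..n} => x i0) em.
rewrite m0 mnmDE addn_eq0 => /andP [/eqP a0 /eqP b0].
by rewrite hu // hv.
Qed.

Lemma agree0_dcoord_form j : agree0 (dcoord_form j) ((X i0)^-1 *: 'X_j).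
Proof.
move=> m m0; rewrite !mcoeffZ mcoeffB mcoeffZ ['X_i0@_m]mcoeffX.
case: eqP => [e|_]; last by rewrite mulr0 subr0.
by move: m0; rewrite -e mnm1E eqxx.
Qed.

Definition form_prod (f : seq 'I_n) : W := \prod_(j <- f) dcoord_form j.

Lemma mcoeff_form_prod f (m : 'X_{1..n}) : m i0 = 0%N ->
  (form_prod f)@_m = (X i0)^-1 ^+ size f * (mcount f == m)%:R.
Proof.
suff H : agree0 (form_prod f) ((X i0)^-1 ^+ size f *: 'X_[mcount f]).
  by move=> m0; rewrite H // mcoeffZ mcoeffX.
rewrite /form_prod /mcount; elim: f => [|j f IHf].
  by rewrite !big_nil expr0 scale1r mpolyX0.
rewrite !big_cons /= mpolyXD exprS -scalerA scalerAr scalerAl.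
by apply: agree0M => //; exact: agree0_dcoord_form.
Qed.

Definition homog_loc (e : nat) (w : W) := forall m, loc I (- e%:Z) w@_m /\
  (w@_m != 0 -> mdeg m = e).

Lemma homog_locM a b u v : homog_loc a u -> homog_loc b v -> homog_loc (a + b) (u * v).
Proof.
move=> hu hv m; rewrite mcoeffM; split.
  apply: loc_sum => -[x y] _ /=; rewrite PoszD opprD.
  by apply: locM; [exact: (hu _).1|exact: (hv _).1].
apply: contraNeq => nd; apply/eqP/big1 => -[x y] /= /eqP em.
have [->|/(hu _).2 ux] := eqVneq u@_x 0; first by rewrite mul0r.
have [->|/(hv _).2 vy] := eqVneq v@_y 0; first by rewrite mulr0.
by case/eqP: nd; rewrite (congr1 mdeg em) mdegD ux vy.
Qed.

Lemma homog_loc_dcoord_form j : homog_loc 1 (dcoord_form j).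
Proof.
move=> m; rewrite mcoeffZ mcoeffB mcoeffZ !mcoeffX; split.
  rewrite -[- _]addr0; apply: locM; first exact: loc_Vhcoord.
  apply: locD; first by rewrite -(rmorph_nat kconst); exact: loc_kconst.
  apply: locN; rewrite mulrC -(rmorph_nat kconst); apply: locZ.
  exact/loc_chart/ratio_in_chart.
have [<-|_] := eqVneq U_(j)%MM m; first by rewrite mdeg1.
have [<-|_] := eqVneq U_(i0)%MM m; first by rewrite mdeg1.
by rewrite mulr0 subr0 mulr0 eqxx.
Qed.

Lemma homog_loc_prod f : homog_loc (size f) (form_prod f).
Proof.
rewrite /form_prod; elim: f => [|j f IHf].
  move=> m; rewrite big_nil mcoeff1 oppr0; split.
    by rewrite -(rmorph_nat kconst); exact: loc_kconst.
  by have [->|_] := eqVneq m 0%MM; rewrite ?mdeg0 ?eqxx.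
by rewrite big_cons; exact: (@homog_locM 1 (size f) _ _ (homog_loc_dcoord_form j) IHf).
Qed.

Lemma eul_form_prod f : eul (form_prod f) = 0.
Proof.
rewrite /form_prod; elim: f => [|j f IHf]; first by rewrite big_nil -(mpolyC1 n K) eulC.
rewrite big_cons eulM IHf mulr0 addr0 /dcoord_form linearZ linearB linearZ /= !eulX.
by rewrite -[(_ / _) *: _]mul_mpolyC -mpolyCM divfK ?hcoord_neq0 // subrr scaler0 mul0r.
Qed.

Lemma Phi_tmon (f : d.-tuple 'I_n) : Phi (tmon p dcoord f) = tau p (form_prod f).
Proof.
rewrite (Phi_prod charkp); congr (tau p _); rewrite /form_prod big_tuple.
by apply: eq_bigr => j _; rewrite ffunE phi_dcoord.
Qed.

Lemma Phi_sum (T : finType) (a : T -> chart k I) (z : T -> TSymOmega k p d I) :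
  Phi (\sum_i a i *: z i) = \sum_i rho I (a i) *: Phi (z i).
Proof.
elim: (index_enum T) => [|i r IHr].
  by rewrite !big_nil -(scale0r 0) (PhiZ charkp) rmorph0 scale0r.
by rewrite !big_cons (PhiD charkp) (PhiZ charkp) IHr.
Qed.

Lemma ker_eul_tmon (f : d.-tuple 'I_n) : ker_eul p d I (Phi (tmon p dcoord f)).
Proof.
rewrite Phi_tmon; split; last by rewrite (eul_tau charkp) eul_form_prod linear0.
move=> m; rewrite mcoeff_tau; case: ifP => hm; last first.
  by rewrite eqxx; split=> //; exact: loc0.
have := homog_loc_prod f m; rewrite size_tuple => -[h1 h2]; split=> // /h2 ->.
by rewrite eqxx.
Qed.

Lemma ker_eul_Phi (x : TSymOmega k p d I) : ker_eul p d I (Phi x).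
Proof.
have [a ->] := tsym_fspan Omega_fspan x; rewrite Phi_sum.
have sM := ker_eul_sub k p (n := n) d.
apply: (submod_sum sM) => f _; have [Cf ef] := ker_eul_tmon f.
split; last by rewrite linearZ /= ef scaler0.
apply: kform_scale Cf; exact/loc_chart/valP.
Qed.

(** The equation [eul v = 0] at [m - U_(i0)] determines the coefficient at [m] from coefficients
    with a smaller exponent of [i0]: its factor [m i0] lies strictly between 0 and [p], hence is
    invertible. So an element of the kernel is determined modulo ['X_i0]. *)
Lemma ker_agree0 (v : W) : truncated p v -> eul v = 0 -> agree0 v 0 -> v = 0.
Proof.
move=> /truncatedP tv ev v0; apply/mpolyP=> m; rewrite mcoeff0.
have [s] := ubnP (m i0); elim: s m => // s IHs m /ltnSE ms.
have [/v0|mi] := eqVneq (m i0) 0%N; first by rewrite mcoeff0.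
have [hm|/forallPn [i hi]] := boolP (mlt p m); last first.
  apply/eqP; apply: contraNT hi => /tv /forallP; exact.
pose m' := (m - U_(i0))%MM; have em : (m' + U_(i0))%MM = m by rewrite submK // lep1mP.
have emi : m i0 = (m' i0).+1 by rewrite -em mnmDE mnm1E eqxx addn1.
have := congr1 (mcoeff m') ev; rewrite mcoeff0 mcoeff_eul (bigD1 i0) //= big1.
  rewrite addr0 em -emi => /eqP; rewrite mulf_eq0 (negPf (hcoord_neq0 _ _)) /=.
  rewrite -mulr_natl mulf_eq0 (negPf (natK_neq0 n charkp _)) => [/eqP//|].
  by rewrite lt0n mi /=; move/forallP: hm; exact.
move=> i ni; rewrite IHs ?mul0rn ?mulr0 // mnmDE mnm1E (negPf ni) addn0.
by rewrite -emi.
Qed.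

(** The preimage is assembled from the coefficients of [w] at monomials free of [i0]. The factor
    [X i0 ^+ d] makes them degree 0 functions and cancels the denominator of the forms; [ker_agree0]
    settles all other coefficients. *)
Lemma Phi_surj (w : W) : ker_eul p d I w -> exists x : TSymOmega k p d I, Phi x = w.
Proof.
move=> [Cw ew].
have /all_sig [f hf] : forall m : 'X_{1..n < d.+1}, {f : d.-tuple 'I_n |
    mdeg m = d -> mcount f = m}.
  move=> m; apply: cid; have [e|ne] := eqVneq (mdeg m) d.
    by have [f fm] := mcount_surj e; exists f.
  by exists [tuple i0 | _ < d] => e; rewrite e eqxx in ne.
have ach (m : 'X_{1..n}) : w@_m * X i0 ^+ d \in in_chart I.
  apply/loc_chart; have -> : 0 = - d%:Z + d%:Z by rewrite addNr.
  apply: locM; first exact: (Cw m).1.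
  elim: d => [|e IHe]; first by rewrite expr0 -(rmorph1 kconst); exact: loc_kconst.
  by rewrite exprS intS; apply: locM => //; exact: loc_hcoord.
pose ok (m : 'X_{1..n}) := (m i0 == 0%N) && (mdeg m == d).
pose b (m : 'X_{1..n}) : chart k I := Sub (w@_m * X i0 ^+ d) (ach m).
pose a (m : 'X_{1..n < d.+1}) : chart k I := if ok m then b m else 0.
pose x : TSymOmega k p d I := \sum_m a m *: tmon p dcoord (f m).
exists x; have [Cx ex] := ker_eul_Phi x.
apply/eqP; rewrite -subr_eq0; apply/eqP; apply: ker_agree0.
- by rewrite /truncated linearB /= (kform_truncated Cx) (kform_truncated Cw).
- by rewrite linearB /= ex ew subrr.
move=> m m0; rewrite mcoeffB mcoeff0; apply/eqP; rewrite subr_eq0; apply/eqP.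
have [okm|nok] := boolP (mlt p m && (mdeg m == d)); last first.
  have nz u : kform p d I u -> u@_m = 0.
    by move=> Cu; apply/eqP; apply: contraNT nok; exact: (Cu m).2.
  by rewrite !nz.
have /andP [hm /eqP dm] := okm.
have md : (mdeg m < d.+1)%N by rewrite dm.
rewrite Phi_sum raddf_sum /= (bigD1 (BMultinom md)) //= big1.
  rewrite addr0 mcoeffZ Phi_tmon mcoeff_tau hm mcoeff_form_prod // hf // eqxx mulr1.
  rewrite /a /ok /= m0 dm !eqxx /= size_tuple -mulrA -exprMn mulfV ?hcoord_neq0 //.
  by rewrite expr1n mulr1.
move=> m' nm; rewrite mcoeffZ /a; case: ifP => [/andP [_ /eqP dm']|_]; last first.
  by rewrite -[X in X * _]/(rho I 0) rmorph0 mul0r.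
rewrite Phi_tmon mcoeff_tau hm mcoeff_form_prod // hf //.
case: eqP => [e|_]; last by rewrite !mulr0.
by case/negP: nm; apply/eqP/val_inj.
Qed.

(* Modulo e_i0 the image of the monomial tmon f is a multiple of the monomial
   with exponents mcount f, so a relation between the images forces the
   coefficients attached to each exponent to add up to 0. *)
Lemma Phi_eq0 (x : TSymOmega k p d I) : Phi x = 0 -> x = 0.
Proof.
have [a ->] := tsym_fspan Omega_fspan x; rewrite Phi_sum => e.
have bd (f : d.-tuple 'I_n) : (mdeg (mcount f) < d.+1)%N.
  by rewrite mdeg_mcount size_tuple.
(* Tuples are grouped by exponents, on which alone [tmon] depends. Groups involving [i0] vanish
   since [dcoord i0 = 0], and groups with an exponent at least [p] vanish by the Frobenius
   relations. *)
rewrite (partition_big (fun f => BMultinom (bd f)) xpredT) //=.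
apply: big1 => m _.
have [f0 /eqP fm|none] := pickP (fun f => BMultinom (bd f) == m); last first.
  by rewrite big_pred0.
have tE f : BMultinom (bd f) == m -> tmon p dcoord f = tmon p dcoord f0.
  by rewrite -fm => /eqP [ef]; exact: tmon_mcount.
rewrite (eq_bigr (fun f => a f *: tmon p dcoord f0)) => [|f /tE ->//].
have mE : mcount f0 = m by rewrite -fm.
rewrite -scaler_suml.
have [m0|m0] := eqVneq ((m : 'X_{1..n}) i0) 0%N; last first.
  by rewrite (tmon_gen0 _ dcoord_i0) ?scaler0 // mE.
have [hm|/forallPn [i hi]] := boolP (mlt p m); last first.
  by rewrite (@tmon_ge_p _ _ _ _ _ _ _ i) ?scaler0 // mE leqNgt.
suff -> : \sum_(f | BMultinom (bd f) == m) a f = 0 by rewrite scale0r.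
apply: val_inj; rewrite -[val _]/(rho I _) -[RHS]/(rho I 0) rmorph0 rmorph_sum.
have /(congr1 (mcoeff m)) := e; rewrite mcoeff0 raddf_sum /= => es.
have X0 : (X i0)^-1 ^+ d != 0 by rewrite expf_neq0 // invr_neq0 // hcoord_neq0.
apply: (mulIf X0); rewrite mul0r mulr_suml -[RHS]es big_mkcond.
apply: eq_bigr => f _ /=; rewrite mcoeffZ Phi_tmon mcoeff_tau hm mcoeff_form_prod //.
by rewrite size_tuple bmeqP /=; case: eqP => _; rewrite ?mulr1 ?mulr0.
Qed.

Lemma Phi_inj : injective (@Phi k p n d I).
Proof.
move=> x y e; apply/eqP; rewrite -subr_eq0; apply/eqP/Phi_eq0.
by rewrite -scaleN1r (PhiD charkp) (PhiZ charkp) rmorphN1 scaleN1r e subrr.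
Qed.

End LocalIso.

(** * Comparison with the Cech complex *)

Section Transfer.
Variables (k : fieldType) (n : nat).
Local Notation K := {fraction {mpoly k[n]}}.
Local Notation kconst := (@kconst k n).
Local Notation rho := (@rho k n).
Variable F : forall I : {set 'I_n}, lmodType (chart k I).
Variable res : forall I J : {set 'I_n}, I \subset J -> F I -> F J.
Variables (W : lmodType K) (Phi : forall I, F I -> W) (M : {set 'I_n} -> W -> Prop).
Hypothesis sM : submodules kconst M.
Hypothesis PhiD : forall I (x y : F I), Phi (x + y) = Phi x + Phi y.
Hypothesis PhiZ : forall I a (x : F I), Phi (a *: x) = rho I a *: Phi x.
Hypothesis Phi_res : forall (I J : {set 'I_n}) (sIJ : I \subset J) (x : F I),
  Phi (res sIJ x) = Phi x.
Hypothesis Phi_inj : forall I, I != set0 -> injective (@Phi I).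
Hypothesis Phi_M : forall I (x : F I), I != set0 -> M I (Phi x).
Hypothesis Phi_surj : forall I w, I != set0 -> M I w -> exists x : F I, Phi x = w.

Let push (c : cochain F) : {set 'I_n} -> W := fun I => Phi (c I).

Let Phi0 I : Phi (0 : F I) = 0.
Proof. by rewrite -(scale0r 0) PhiZ rmorph0 scale0r. Qed.

Let Phi_sum I T (r : seq T) (P : pred T) (G : T -> F I) :
  Phi (\sum_(i <- r | P i) G i) = \sum_(i <- r | P i) Phi (G i).
Proof. exact: (big_morph (@Phi I) (@PhiD I) (Phi0 I)). Qed.

Let PhiB I (x y : F I) : Phi (x - y) = Phi x - Phi y.
Proof. by rewrite -scaleN1r PhiD PhiZ rmorphN1 scaleN1r. Qed.

Let push_diff c J : Phi (cech_diff res c J) = delta (push c) J.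
Proof.
rewrite Phi_sum; apply: eq_bigr => i _.
by rewrite PhiZ Phi_res -[in LHS]signr_odd rmorph_sign signr_odd.
Qed.

Let push_comb h (b : 'I_h -> cochain F) a J :
  Phi (lin_comb b a J) = comb kconst (fun i => push (b i)) a J.
Proof. by rewrite Phi_sum; apply: eq_bigr => i _; rewrite PhiZ. Qed.

Let in_degree0 j (c : cochain F) : in_degree j c -> c set0 = 0.
Proof. by apply; rewrite cards0. Qed.

Let push_coch j c : in_degree j c -> coch M j (push c).
Proof.
move=> hc I; split=> [|nI]; last by rewrite /push hc // Phi0.
have [->|I0] := eqVneq I set0; last exact: Phi_M.
by rewrite /push (in_degree0 hc) Phi0; exact: submod0 sM _.
Qed.

Let lift_coch j c : coch M j c -> exists2 b : cochain F, in_degree j b & push b = c.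
Proof.
move=> Mc.
have /all_sig [b hb] : forall I, {x : F I | Phi x = c I /\ (#|I| != j.+1 -> x = 0)}.
  move=> I; apply: cid; have [eI|nI] := eqVneq #|I| j.+1; last first.
    by exists 0; rewrite Phi0 (Mc I).2.
  have I0 : I != set0 by rewrite -card_gt0 eI.
  by have [x xc] := Phi_surj I0 (Mc I).1; exists x.
by exists b => [I /(hb I).2|]; last by apply/funext => I; case: (hb I).
Qed.

(** [Phi] is not assumed injective over the empty set, so equality there is supplied separately:
    cochains vanish on it and [cech_diff] is an empty sum. *)
Let eq_push (c b : cochain F) : c set0 = b set0 -> (forall I, Phi (c I) = Phi (b I)) ->
  forall I, c I = b I.
Proof.
move=> e0 e I; have [->|I0] := eqVneq I set0; first exact: e0.
exact: (Phi_inj I0).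
Qed.

Let push_cocyc j c : cocycle res j c <-> in_degree j c /\ cocyc M j (push c).
Proof.
split=> [[hc dc]|[hc [_ dc]]]; split=> //.
  by split=> [|J]; [exact: push_coch|rewrite -push_diff dc Phi0].
apply: (eq_push (b := fun J => 0)) => [|J]; first by rewrite /cech_diff big_set0.
by rewrite push_diff dc Phi0.
Qed.

Let push_cobound j c : in_degree j c ->
  coboundary res j c <-> cobound M j (push c).
Proof.
case: j => [|j] hc /=; split.
- by move=> c0 J; rewrite /push c0 Phi0.
- move=> c0; apply: (eq_push (b := fun J => 0)) => [|J]; first exact: in_degree0 hc.
  by rewrite Phi0; exact: c0.
- move=> [b hb e]; exists (push b); first exact: push_coch.
  by move=> J; rewrite -push_diff -e.
move=> [t Mt e]; have [b hb eb] := lift_coch Mt; exists b => //.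
apply: eq_push => [|J]; first by rewrite (in_degree0 hc) /cech_diff big_set0.
by rewrite push_diff eb -e.
Qed.

Lemma cech_dim_transfer j h : cohdim kconst M j h -> cech_dim res j h.
Proof.
move=> [b0 zb0 Hb0].
have /all_sig2 [b hb eb] : forall i, {b : cochain F | in_degree j b & push b = b0 i}.
  by move=> i; apply/cid2/lift_coch/(zb0 i).1.
exists b => [i|z /push_cocyc [hz zz]].
  by apply/push_cocyc; split=> //; rewrite eb.
have E a : coboundary res j (fun J => z J - lin_comb b a J) <->
           cobound M j (fun J => push z J - comb kconst b0 a J).
  have hd : in_degree j (fun J => z J - lin_comb b a J).
    move=> I nI; rewrite hz // /lin_comb big1 ?subr0 // => i _.
    by rewrite (hb i) // scaler0.
  rewrite (push_cobound hd) (_ : push _ = fun J => push z J - comb kconst b0 a J) //.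
  apply/funext => J; rewrite /push PhiB push_comb; congr (_ - _).
  by apply: eq_bigr => i _; rewrite eb.
have [a [az au]] := Hb0 _ zz; exists a; split; first exact/E.
by move=> a' /E /au.
Qed.

End Transfer.

Lemma cech_dim_TSymOmega (k : fieldType) (p : nat) (charkp : p \in [pchar k])
    (d n j : nat) : (d < n)%N ->
  cech_dim (@TSymOmega_res k p d n) j ((d %% p <= 1)%N && (j == p_index p d)).
Proof.
move=> dn; apply: (@cech_dim_transfer k n _ _ _ (@Phi k p n d) (@ker_eul k p n d)).
- exact: ker_eul_sub.
- exact: PhiD.
- exact: PhiZ.
- by move=> I J sIJ x; exact: Phi_res.
- by move=> I /set0Pn [i iI]; exact: (Phi_inj charkp iI).
- by move=> I x /set0Pn [i iI]; exact: (ker_eul_Phi charkp iI).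
- by move=> I w /set0Pn [i iI]; exact: (Phi_surj charkp iI).
- exact: cohdim_ker_eul.
Qed.

Theorem mainTheorem6 (k : closedFieldType) (p : nat) (charkp : p \in [pchar k]%R)
    (d : nat) :
  (~ (d = 0 %[mod p] \/ d = 1 %[mod p]) ->
     forall j : nat, hst_TSymOmega k p d j 0) /\
  (d = 0 %[mod p] \/ d = 1 %[mod p] ->
     hst_TSymOmega k p d (p_index p d) 1 /\
     forall j : nat, j <> p_index p d -> hst_TSymOmega k p d j 0).
Proof.
have p1 : (1 < p)%N := prime_gt1 (pcharf_prime charkp).
have dE : (d = 0 %[mod p] \/ d = 1 %[mod p]) <-> (d %% p <= 1)%N.
  rewrite mod0n (modn_small p1); case: (d %% p)%N => [|[|r]]; split=> //; try by auto.
  by case.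
have H j h : h = ((d %% p <= 1)%N && (j == p_index p d)) :> nat -> hst_TSymOmega k p d j h.
  (* From [n = d + 1] on, every twist O(-m) in the complex has [m < n]. *)
  by move=> ->; exists d.+1 => n dn; exact: cech_dim_TSymOmega.
rewrite dE; split=> [/negP/negPf dp j|dp]; first by apply: H; rewrite dp.
split=> [|j /eqP/negPf nj]; apply: H; rewrite dp ?eqxx ?nj //.
Qed.
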